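(* Let $e$ be a closed expression of the concurrent affine language $\lambda_{\mathsf{aff}}$ with $\vdash e:\tau$. Then for any threadpool $\vec\alpha$ and states $\sigma,\sigma'$ such that $([[\![e]\!]],\sigma)\to_{\mathsf{tp}}^*(\vec\alpha,\sigma')$, every thread in $\vec\alpha$ is either a value or can take a step (i.e. for each thread $\alpha_i$ of $\vec\alpha$, either $\alpha_i$ is a value or there are $\beta,\sigma'',\vec l$ with $(\alpha_i,\sigma')\to(\beta,\sigma'',\vec l)$).
   Context: Guarded interaction trees: in guarded type theory (Iris base logic) with later $\triangleright$, $\mathsf{Next}$, functorial action of $\triangleright$ and guarded fixed points, $\mathit{IT}$ has constructors $\mathsf{Ret}$ (ground type containing $\mathbb N$, unit, locations, and pairs of values), $\mathsf{Fun}:\triangleright(\mathit{IT}\to\mathit{IT})\to\mathit{IT}$, $\mathsf{Err}$ (errors include $\mathsf{RunTime}$ and a linearity error $\mathsf{Lin}$), $\mathsf{Tau}$, $\mathsf{Vis}_i:\mathsf{Ins}_i(\mathit{IT})\times(\mathsf{Outs}_i(\mathit{IT})\to\triangleright\mathit{IT})\to\mathit{IT}$; $\mathsf{Tick}=\mathsf{Tau}\circ\mathsf{Next}$; values are $\mathsf{Ret}(a),\mathsf{Fun}(f)$. Reifiers have type $r_i:\mathsf{Ins}_i(\mathit{IT})\times S\times(\mathsf{Outs}_i(\mathit{IT})\to\triangleright\mathit{IT})\to\mathsf{option}(\triangleright\mathit{IT}\times S\times\mathsf{list}(\triangleright\mathit{IT}))$, the list being newly forked threads. Single-thread reduction: $(\alpha,\sigma)\to(\beta,\sigma',\vec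 l)$ iff $\alpha=\mathsf{Tick}\,\beta$, $\sigma'=\sigma$, $\vec l=[]$, or $\alpha=\mathsf{Vis}_i(x,k)$ and $r_i(x,\sigma,k)=\mathsf{Some}(\mathsf{Next}\,\beta,\sigma',\vec l')$ with $\vec l$ the threads of $\vec l'$. Threadpool reduction: $(\vec\alpha,\sigma)\to_{\mathsf{tp}}(\vec\alpha',\sigma')$ iff for some index $i$, $(\vec\alpha[i],\sigma)\to(\alpha_i',\sigma',\vec l)$ and $\vec\alpha'=\vec\alpha[i\mapsto\alpha_i']\mathbin{++}\vec l$. Helpers $\mathsf{getval},\mathsf{getret}$, strict application $\mathsf{APP}$, and $\mathsf{LET}\ x=\alpha\ \mathsf{IN}\ f(x)\equiv\mathsf{getval}(\alpha,f)$, $\alpha;\beta\equiv\mathsf{getval}(\alpha,\lambda\_.\beta)$, $\mathsf{IF}(\alpha,\beta,\gamma)$ evaluates $\alpha$ to $\mathsf{Ret}(n)$ and continues with $\beta$ if $n\neq0$, $\gamma$ if $n=0$. Effects: heap state $S$ maps locations to $\triangleright\mathit{IT}$. $\mathsf{ALLOC}(\alpha,k)$ stores $\alpha$ at a fresh $\ell$ and continues with $k(\ell)$; $\mathsf{DEALLOC}(\ell)$ removes $\ell$; the atomic effect has $\mathsf{Ins}_{\mathsf{atomic}}(X)=\mathsf{Loc}\times\triangleright(X\to X\times X)$, $\mathsf{Outs}_{\mathsf{atomic}}(X)=\triangleright X$, $r_{\mathsf{atomic}}((\ell,f),\sigma,\kappa)=\mathsf{Some}(\kappa(\mathsf{Next}\,r),\sigma[\ell\mapsto\mathsf{Next}\,v'],[])$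 if $\sigma(\ell)=\mathsf{Next}\,v$ and $f(v)=\mathsf{Next}(r,v')$, else $\mathsf{None}$; $\mathsf{XCHG}(\ell,w)=\mathsf{Vis}_{\mathsf{atomic}}((\ell,\lambda x.(x,w)),\mathrm{id})$ (returns the old value and stores $w$). Fork: $\mathsf{Ins}_{\mathsf{fork}}(X)=\triangleright X$, $\mathsf{Outs}_{\mathsf{fork}}(X)=1$, $r_{\mathsf{fork}}(e,\sigma,\kappa)=\mathsf{Some}(\kappa(),\sigma,[e])$, $\mathsf{FORK}(e)=\mathsf{Vis}_{\mathsf{fork}}(\mathsf{Next}\,e,\lambda x.\mathsf{Next}(\mathsf{Ret}\,x))$. Other reifiers return no new threads. Thunks: $\mathsf{Thunk}(\alpha)=\mathsf{ALLOC}(\mathsf{Ret}(0),\lambda\ell.\mathsf{Fun}(\mathsf{Next}(\lambda\_.\mathsf{IF}(\mathsf{XCHG}(\ell,\mathsf{Ret}(1)),\mathsf{Err}(\mathsf{Lin}),\alpha))))$, $\mathsf{Force}(\alpha)=\mathsf{APP}(\alpha,\mathsf{Ret}(0))$. Language $\lambda_{\mathsf{aff}}$: types $\tau::=\mathsf{bool}\mid\mathsf{nat}\mid\mathsf{unit}\mid\tau_1\otimes\tau_2\mid\tau_1\multimap\tau_2\mid\mathsf{ref}\,\tau$; expressions $e::=n\mid b\mid()\mid x\mid\lambda x.e\mid e_1e_2\mid\langle e_1,e_2\rangle\mid\mathsf{let}\ \langle x_1,x_2\rangle=e_1\ \mathsf{in}\ e_2\mid\mathsf{alloc}(e)\mid\mathsf{dealloc}(e)\mid\mathsf{replace}(e_1,e_2)\mid\mathsf{fork}(e_1,e_2)$.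 Affine typing rules: $\Gamma\vdash b:\mathsf{bool}$, $\Gamma\vdash n:\mathsf{nat}$, $\Gamma\vdash():\mathsf{unit}$, $\Gamma_1,x:\tau,\Gamma_2\vdash x:\tau$; $x:\tau_1,\Gamma\vdash e:\tau_2\Rightarrow\Gamma\vdash\lambda x.e:\tau_1\multimap\tau_2$; $\Gamma_1\vdash e_1:\tau_1\multimap\tau_2$, $\Gamma_2\vdash e_2:\tau_1\Rightarrow\Gamma_1,\Gamma_2\vdash e_1e_2:\tau_2$; $\Gamma_1\vdash e_1:\tau_1$, $\Gamma_2\vdash e_2:\tau_2\Rightarrow\Gamma_1,\Gamma_2\vdash\langle e_1,e_2\rangle:\tau_1\otimes\tau_2$; $\Gamma_1\vdash e_1:\tau_1\otimes\tau_2$, $x_1:\tau_1,x_2:\tau_2,\Gamma_2\vdash e_2:\tau\Rightarrow\Gamma_1,\Gamma_2\vdash\mathsf{let}\ \langle x_1,x_2\rangle=e_1\ \mathsf{in}\ e_2:\tau$; $\Gamma\vdash e:\tau\Rightarrow\Gamma\vdash\mathsf{alloc}(e):\mathsf{ref}\,\tau$; $\Gamma\vdash e:\mathsf{ref}\,\tau\Rightarrow\Gamma\vdash\mathsf{dealloc}(e):\mathsf{unit}$; $\Gamma_1\vdash e_1:\mathsf{ref}\,\tau_1$, $\Gamma_2\vdash e_2:\tau_2\Rightarrow\Gamma_1,\Gamma_2\vdash\mathsf{replace}(e_1,e_2):\tau_1\otimes\mathsf{ref}\,\tau_2$; $\Gamma_1\vdash e_1:\mathsf{unit}$, $\Gamma_2\vdash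 e_2:\tau\Rightarrow\Gamma_1,\Gamma_2\vdash\mathsf{fork}(e_1,e_2):\tau$. Interpretation ($\rho_1,\rho_2$ the restrictions of $\rho$ to the contexts $\Gamma_1,\Gamma_2$): $[\![b]\!]=\mathsf{Ret}(1)$ if $b$ true, else $\mathsf{Ret}(0)$; $[\![()]\!]=\mathsf{Ret}()$; $[\![n]\!]=\mathsf{Ret}(n)$; $[\![\lambda x.e]\!]_\rho=\mathsf{Fun}(\mathsf{Next}(\lambda\alpha.[\![e]\!]_{\rho[x\mapsto\alpha]}))$; $[\![x]\!]_\rho=\mathsf{Force}(\rho(x))$; $[\![e_1e_2]\!]_\rho=\mathsf{LET}\ x=[\![e_2]\!]_{\rho_2}\ \mathsf{IN}\ \mathsf{APP}([\![e_1]\!]_{\rho_1},\mathsf{Thunk}(x))$; $[\![\mathsf{let}\ \langle x_1,x_2\rangle=e_1\ \mathsf{in}\ e_2]\!]_\rho=\mathsf{LET}\ x=[\![e_1]\!]_{\rho_1}\ \mathsf{IN}\ \mathsf{LET}\ y=\mathsf{Thunk}(\pi_1 x)\ \mathsf{IN}\ \mathsf{LET}\ z=\mathsf{Thunk}(\pi_2 x)\ \mathsf{IN}\ [\![e_2]\!]_{\rho_2[x_1\mapsto y,x_2\mapsto z]}$; $[\![\langle e_1,e_2\rangle]\!]_\rho=([\![e_1]\!]_{\rho_1},[\![e_2]\!]_{\rho_2})$ (pair formed after evaluating both components); $[\![\mathsf{alloc}(e)]\!]_\rho=\mathsf{LET}\ x=[\![e]\!]_\rho\ \mathsf{IN}\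 \mathsf{ALLOC}(x,\mathsf{Ret})$; $[\![\mathsf{dealloc}(e)]\!]_\rho=\mathsf{getret}([\![e]\!]_\rho,\mathsf{DEALLOC})$; $[\![\mathsf{replace}(e_1,e_2)]\!]_\rho=\mathsf{LET}\ y=[\![e_2]\!]_{\rho_2}\ \mathsf{IN}\ \mathsf{getret}([\![e_1]\!]_{\rho_1},\lambda\ell.\mathsf{LET}\ x=\mathsf{XCHG}(\ell,y)\ \mathsf{IN}\ (x,\mathsf{Ret}(\ell)))$; $[\![\mathsf{fork}(e_1,e_2)]\!]_\rho=\mathsf{FORK}([\![e_1]\!]_{\rho_1});[\![e_2]\!]_{\rho_2}$. $[\![e]\!]$ denotes the interpretation of a closed $e$ in the empty environment. *)

(* Defs.v *)
From Stdlib Require Import Program.Tactics Relation_Operators.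
From HB Require Import structures.
From mathcomp Require Import all_boot finmap boolp.

Set Implicit Arguments.
Unset Strict Implicit.
Unset Printing Implicit Defensive.

(* The model of guarded type theory: types are complete bisected ultrametric
   spaces, given by a decreasing family of equivalence relations [dist n] ("equal
   up to step n"); terms are nonexpansive maps.  These are Iris's COFEs in which
   the equivalence [forall n, dist n x y] is Leibniz equality. *)

Record cofe := Cofe {
  cofe_car :> Type;
  dist : nat -> cofe_car -> cofe_car -> Prop;
  dist_refl : forall n x, dist n x x;
  dist_sym : forall n x y, dist n x y -> dist n y x;
  dist_trans : forall n x y z, dist n x y -> dist n y z -> dist n x z;
  dist_le : forall m n x y, m <= n -> dist n x y -> dist m x y;
  dist_eq : forall x y, (forall n, dist n x y) -> x = y;
  dist_complete : forall c : nat -> cofe_car,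
    (forall n m, n <= m -> dist n (c m) (c n)) ->
    exists x, forall n, dist n x (c n)
}.
Arguments dist {A} n x y : rename.
Arguments dist_refl {_} n x.
#[global] Hint Resolve dist_refl : core.

Definition chain (A : cofe) (c : nat -> A) :=
  forall n m, n <= m -> dist n (c m) (c n).

Definition lim (A : cofe) (c : nat -> A) (cP : chain c) : A :=
  projT1 (cid (dist_complete cP)).

Lemma limP (A : cofe) (c : nat -> A) (cP : chain c) n : dist n (lim cP) (c n).
Proof. exact: (projT2 (cid (dist_complete cP))). Qed.

(* [near true n] is the distance at the strictly earlier steps, i.e. the
   distance at step n under a later; it holds trivially at step 0. *)
Definition near (c : bool) n (A : cofe) (x y : A) : Prop :=
  if c then forall m, m < n -> dist m x y else dist n x y.

Lemma near_refl c n (A : cofe) (x : A) : near c n x x.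
Proof. by case: c => /=. Qed.
#[global] Hint Resolve near_refl : core.

Lemma dist_near c n (A : cofe) (x y : A) : dist n x y -> near c n x y.
Proof. by case: c => //= xy m /ltnW/dist_le; apply. Qed.

Record nemor (A B : cofe) := NeMor {
  nm_fun :> A -> B;
  nm_ne : forall n x y, dist n x y -> dist n (nm_fun x) (nm_fun y)
}.
Arguments NeMor {A B} nm_fun nm_ne.

Lemma nemor_eq (A B : cofe) (f g : nemor A B) : (forall x, f x = g x) -> f = g.
Proof.
case: f g => [f fP] [g gP] /= /funext fg; move: fP gP; rewrite fg => fP gP.
by congr NeMor; exact: Prop_irrelevance.
Qed.

Section NeCofe.
Variables A B : cofe.
Definition ne_dist n (f g : nemor A B) := forall x, dist n (f x) (g x).

Lemma ne_complete (c : nat -> nemor A B) :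
  (forall n m, n <= m -> ne_dist n (c m) (c n)) ->
  exists x, forall n, ne_dist n x (c n).
Proof.
move=> cP; have cPx x : chain (c^~ x) by move=> n m nm; exact: cP.
unshelve eexists (NeMor (fun x => lim (cPx x)) _); last by move=> n x; exact: limP.
move=> n x y xy; apply: dist_trans (limP _ n) _.
apply: dist_trans (dist_sym (limP _ n)); exact: nm_ne.
Qed.

Definition neC : cofe.
Proof.
refine (@Cofe (nemor A B) ne_dist _ _ _ _ _ ne_complete).
- by move=> n f x.
- by move=> n f g fg x; exact: dist_sym.
- by move=> n f g h fg gh x; exact: dist_trans (fg x) (gh x).
- by move=> m n f g mn fg x; exact: dist_le (fg x).
- by move=> f g fg; apply: nemor_eq => x; apply: dist_eq => n; exact: fg.
Defined.
End NeCofe.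
Canonical neC.
Notation "A -n> B" := (neC A B) (at level 99, B at level 200, right associativity).

Lemma ne_app (A B : cofe) n (f g : A -n> B) (x y : A) :
  dist n f g -> dist n x y -> dist n (f x) (g y).
Proof. by move=> fg xy; apply: dist_trans (fg x) _; exact: nm_ne. Qed.

Definition idN (A : cofe) : A -n> A := NeMor id (fun _ _ _ => id).
Definition compN (A B C : cofe) (g : B -n> C) (f : A -n> B) : A -n> C :=
  @NeMor A C (g \o f) (fun _ _ _ xy => nm_ne g (nm_ne f xy)).

Lemma near_app c n (A B : cofe) (f g : A -n> B) (x : A) :
  near c n f g -> near c n (f x) (g x).
Proof. by case: c => [fg m mn|fg] /=; [exact: fg|exact: fg]. Qed.

Lemma near_comp c n (A B C : cofe) (g g' : B -n> C) (f f' : A -n> B) :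
  near c n g g' -> near c n f f' -> near c n (compN g f) (compN g' f').
Proof.
case: c => [gg ff m mn x|gg ff x] /=; apply: ne_app.
- exact: gg. - exact: ff. - exact: gg. - exact: ff.
Qed.

Definition discC (T : Type) : cofe.
Proof.
refine (@Cofe T (fun _ x y => x = y) _ _ _ _ _ _) => //.
- by move=> _ x y z -> ->.
- by move=> x y xy; exact: (xy 0).
- by move=> c cP; exists (c 0) => n; rewrite (cP 0 n).
Defined.

Definition unitC := discC unit.

Definition dfunC (T : Type) (A : cofe) : cofe.
Proof.
refine (@Cofe (T -> A) (fun n f g => forall x, dist n (f x) (g x)) _ _ _ _ _ _).
- by [].
- by move=> n f g fg x; exact: dist_sym.
- by move=> n f g h fg gh x; exact: dist_trans (fg x) (gh x).
- by move=> m n f g mn fg x; exact: dist_le (fg x).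
- by move=> f g fg; apply: funext => x; apply: dist_eq => n; exact: fg.
- move=> c cP; have cPx x : chain (c^~ x) by move=> n m nm; exact: cP.
  by exists (fun x => lim (cPx x)) => n x; exact: limP.
Defined.

Definition prodC (A B : cofe) : cofe.
Proof.
refine (@Cofe (A * B)
  (fun n p q => dist n p.1 q.1 /\ dist n p.2 q.2) _ _ _ _ _ _).
- by [].
- by move=> n p q [? ?]; split; exact: dist_sym.
- by move=> n p q r [p1 p2] [q1 q2]; split; [exact: dist_trans q1|exact: dist_trans q2].
- by move=> m n p q mn [? ?]; split; exact: dist_le mn _.
- move=> [a b] [a' b'] H; congr pair; apply: dist_eq => n; by case: (H n).
- move=> c cP.
  have c1 : chain (fun n => (c n).1) by move=> n m nm; case: (cP n m nm).
  have c2 : chain (fun n => (c n).2) by move=> n m nm; case: (cP n m nm).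
  by exists (lim c1, lim c2) => n; split; exact: limP.
Defined.

Section SumCofe.
Variables A B : cofe.
Definition sum_dist n (p q : A + B) := match p, q with
  | inl x, inl y => dist n x y | inr x, inr y => dist n x y | _, _ => False end.

Definition sumC : cofe.
Proof.
refine (@Cofe (A + B) sum_dist _ _ _ _ _ _).
- by move=> n [x|x] /=.
- by move=> n [x|x] [y|y] //=; exact: dist_sym.
- by move=> n [x|x] [y|y] [z|z] //=; exact: dist_trans.
- by move=> m n [x|x] [y|y] //= mn; exact: dist_le.
- move=> [x|x] [y|y] /= H; try by case: (H 0).
  + by congr inl; apply: dist_eq => n; exact: (H n).
  + by congr inr; apply: dist_eq => n; exact: (H n).
- move=> c cP; case E : (c 0) => [x0|x0].
  + pose c' n := if c n is inl x then x else x0.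
    have cE n : c n = inl (c' n).
      by rewrite /c'; have := cP 0 n (leq0n n); rewrite E; case: (c n).
    have c'P : chain c' by move=> n m nm; have := cP n m nm; rewrite !cE.
    by exists (inl (lim c'P)) => n; rewrite cE; exact: limP.
  + pose c' n := if c n is inr x then x else x0.
    have cE n : c n = inr (c' n).
      by rewrite /c'; have := cP 0 n (leq0n n); rewrite E; case: (c n).
    have c'P : chain c' by move=> n m nm; have := cP n m nm; rewrite !cE.
    by exists (inr (lim c'P)) => n; rewrite cE; exact: limP.
Defined.
End SumCofe.

Section SigCofe.
Variables (I : Type) (A : I -> cofe).
Definition sig_dist n (p q : {i : I & A i}) :=
  exists e : tag p = tag q, dist n (eq_rect _ A (tagged p) _ e) (tagged q).

Lemma sig_dist_refl n p : sig_dist n p p.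
Proof. by exists erefl => /=. Qed.

Lemma sig_distE n i (x y : A i) :
  sig_dist n (existT _ i x) (existT _ i y) <-> dist n x y.
Proof.
split; last by exists erefl.
by case=> /= e; rewrite (Prop_irrelevance e erefl).
Qed.

Definition sigC : cofe.
Proof.
refine (@Cofe {i : I & A i} sig_dist sig_dist_refl _ _ _ _ _).
- move=> n [i x] [j y] [/= e]; case: j / e y => y /= xy.
  by apply/sig_distE; exact: dist_sym.
- move=> n [i x] [j y] [k z] [/= e]; case: j / e y => y /= xy [/= e].
  by case: k / e z => z /= yz; apply/sig_distE; exact: dist_trans yz.
- move=> m n [i x] [j y] mn [/= e]; case: j / e y => y /= xy.
  by apply/sig_distE; exact: dist_le xy.
- move=> [i x] [j y] H; case: (H 0) => /= e _; case: j / e y H => y H.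
  by congr existT; apply: dist_eq => n; apply/sig_distE; exact: H.
- move=> c cP; case E : (c 0) => [i x0].
  have /choice[c' cE] n : exists x, c n = existT _ i x.
    have := cP 0 n (leq0n n); rewrite E; case: (c n) => j x [/= e _].
    by case: i / e x0 E => _ _; exists x.
  have c'P : chain c'.
    by move=> n m nm; apply/sig_distE; rewrite -!cE; exact: cP.
  by exists (existT _ i (lim c'P)) => n; rewrite cE; apply/sig_distE; exact: limP.
Defined.

Lemma sig_distP n (p q : sigC) : dist n p q ->
  exists i (x y : A i), [/\ p = existT _ i x, q = existT _ i y & dist n x y].
Proof.
case: p q => i x [j y] [/= e]; case: j / e y => y /= xy.
by exists i, x, y.
Qed.

Definition inS (i : I) : A i -n> sigC :=
  @NeMor (A i) sigC (existT _ i) (fun _ _ _ xy => ex_intro _ erefl xy).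
End SigCofe.

#[projections(primitive)]
Record later (A : Type) := Next { later_car : A }.
Arguments Next {A} later_car.

Definition laterC (A : cofe) : cofe.
Proof.
refine (@Cofe (later A)
  (fun n x y => near true n (later_car x) (later_car y)) _ _ _ _ _ _).
- by [].
- by move=> n x y xy m mn; apply: dist_sym; exact: xy.
- by move=> n x y z xy yz m mn; apply: dist_trans (xy m mn) (yz m mn).
- by move=> m n x y mn xy p pm; apply: xy; exact: leq_trans mn.
- move=> [x] [y] /= xy; congr Next; apply: dist_eq => n.
  exact: (xy n.+1 n (leqnn _)).
- move=> c cP; pose c' n := later_car (c n.+1).
  have c'P : chain c' by move=> n m nm; apply: (cP n.+1 m.+1).
  exists (Next (lim c'P)) => n m mn /=; apply: dist_trans (limP _ m) _.
  by apply: dist_sym; apply: (cP m.+1 n).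
Defined.

Definition NextN (A : cofe) : A -n> laterC A :=
  @NeMor A (laterC A) Next (fun n x y xy => dist_near true xy).

Definition loc := nat.

(* [L] stands for the type of the functions in [Fun]; [ground] is the argument
   type of [Ret] and [gvalue] consists of the values [Ret a] and [Fun f]. *)
Inductive ground (L : Type) : Type :=
  | GNat (n : nat)
  | GUnit
  | GLoc (l : loc)
  | GPair (v1 v2 : gvalue L)
with gvalue (L : Type) : Type :=
  | VRet (a : ground L)
  | VFun (f : L).
Arguments GNat {L} n.
Arguments GUnit {L}.
Arguments GLoc {L} l.

Scheme ground_mut := Induction for ground Sort Prop
  with gvalue_mut := Induction for gvalue Sort Prop.
Combined Scheme ground_gvalue_ind from ground_mut, gvalue_mut.

Fixpoint ground_map L M (h : L -> M) (a : ground L) : ground M :=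
  match a with
  | GNat n => GNat n
  | GUnit => GUnit
  | GLoc l => GLoc l
  | GPair v1 v2 => GPair (gvalue_map h v1) (gvalue_map h v2)
  end
with gvalue_map L M (h : L -> M) (v : gvalue L) : gvalue M :=
  match v with
  | VRet a => VRet (ground_map h a)
  | VFun f => VFun (h f)
  end.

Section GroundCofe.
Variable L : cofe.

Fixpoint ground_dist n (a b : ground L) : Prop :=
  match a, b with
  | GNat i, GNat j => i = j
  | GUnit, GUnit => True
  | GLoc i, GLoc j => i = j
  | GPair v1 v2, GPair w1 w2 => gvalue_dist n v1 w1 /\ gvalue_dist n v2 w2
  | _, _ => False
  end
with gvalue_dist n (v w : gvalue L) : Prop :=
  match v, w with
  | VRet a, VRet b => ground_dist n a b
  | VFun f, VFun g => dist n f g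
  | _, _ => False
  end.

Lemma ground_refl n : (forall a, ground_dist n a a) /\ (forall v, gvalue_dist n v v).
Proof. by apply: ground_gvalue_ind => //=. Qed.

Lemma ground_sym n : (forall a b, ground_dist n a b -> ground_dist n b a) /\
  (forall v w, gvalue_dist n v w -> gvalue_dist n w v).
Proof.
apply: ground_gvalue_ind.
- by move=> i [].
- by case.
- by move=> i [].
- by move=> v1 I1 v2 I2 [] //= w1 w2 [? ?]; split; [exact: I1|exact: I2].
- by move=> a I [] //= b; exact: I.
- by move=> f [] //= g; exact: dist_sym.
Qed.

Lemma ground_trans n : (forall a b c, ground_dist n a b -> ground_dist n b c -> ground_dist n a c) /\
  (forall v w u, gvalue_dist n v w -> gvalue_dist n w u -> gvalue_dist n v u).
Proof.
apply: ground_gvalue_ind.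
- by move=> i [] // j [] //= k -> ->.
- by case=> // -[].
- by move=> i [] // j [] //= k -> ->.
- move=> v1 I1 v2 I2 [] //= w1 w2 [] //= u1 u2 [? ?] [? ?].
  by split; [apply: (I1 w1)|apply: (I2 w2)].
- by move=> a I [] //= b [] //= c; exact: I.
- by move=> f [] //= g [] //= h; exact: dist_trans.
Qed.

Lemma ground_le m n : m <= n -> (forall a b, ground_dist n a b -> ground_dist m a b) /\
  (forall v w, gvalue_dist n v w -> gvalue_dist m v w).
Proof.
move=> mn; apply: ground_gvalue_ind.
- by move=> i [].
- by case.
- by move=> i [].
- by move=> v1 I1 v2 I2 [] //= w1 w2 [? ?]; split; [exact: I1|exact: I2].
- by move=> a I [] //= b; exact: I.
- by move=> f [] //= g; exact: dist_le.
Qed.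

Lemma ground_sep : (forall a b, (forall n, ground_dist n a b) -> a = b) /\
  (forall v w, (forall n, gvalue_dist n v w) -> v = w).
Proof.
apply: ground_gvalue_ind.
- by move=> i [] /= => [j|||] H; rewrite ?(H 0) //; case: (H 0).
- by case => // [i|i|v w] H; case: (H 0).
- by move=> i [] /= => [||j|] H; rewrite ?(H 0) //; case: (H 0).
- move=> v1 I1 v2 I2 [] /= => [j||j|w1 w2] H; try by case: (H 0).
  by congr GPair; [apply: I1|apply: I2] => n; case: (H n).
- by move=> a I [] /= => [b|g] H; [congr VRet; exact: I|case: (H 0)].
- by move=> f [] /= => [b|g] H; [case: (H 0)|congr VFun; exact: dist_eq].
Qed.

Lemma ground_complete :
  (forall a (c : nat -> ground L), c 0 = a ->
    (forall n m, n <= m -> ground_dist n (c m) (c n)) ->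
    exists x, forall n, ground_dist n x (c n)) /\
  (forall v (c : nat -> gvalue L), c 0 = v ->
    (forall n m, n <= m -> gvalue_dist n (c m) (c n)) ->
    exists x, forall n, gvalue_dist n x (c n)).
Proof.
apply: ground_gvalue_ind.
- move=> i c c0 cP; exists (GNat i) => n; have := cP 0 n (leq0n n).
  by rewrite c0; case: (c n).
- move=> c c0 cP; exists GUnit => n; have := cP 0 n (leq0n n).
  by rewrite c0; case: (c n).
- move=> i c c0 cP; exists (GLoc i) => n; have := cP 0 n (leq0n n).
  by rewrite c0; case: (c n).
- move=> v1 I1 v2 I2 c c0 cP.
  pose c1 n := if c n is GPair w _ then w else v1.
  pose c2 n := if c n is GPair _ w then w else v2.
  have cE n : c n = GPair (c1 n) (c2 n).
    by rewrite /c1 /c2; have := cP 0 n (leq0n n); rewrite c0; case: (c n).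
  have [||x1 x1P] := I1 c1; first by rewrite /c1 c0.
    by move=> n m nm; have := cP n m nm; rewrite !cE => -[].
  have [||x2 x2P] := I2 c2; first by rewrite /c2 c0.
    by move=> n m nm; have := cP n m nm; rewrite !cE => -[].
  by exists (GPair x1 x2) => n; rewrite cE.
- move=> a I c c0 cP; pose c1 n := if c n is VRet b then b else a.
  have cE n : c n = VRet (c1 n).
    by rewrite /c1; have := cP 0 n (leq0n n); rewrite c0; case: (c n).
  have [||x xP] := I c1; first by rewrite /c1 c0.
    by move=> n m nm; have := cP n m nm; rewrite !cE.
  by exists (VRet x) => n; rewrite cE.
- move=> f c c0 cP; pose c1 n := if c n is VFun g then g else f.
  have cE n : c n = VFun (c1 n).
    by rewrite /c1; have := cP 0 n (leq0n n); rewrite c0; case: (c n).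
  have c1P : chain c1 by move=> n m nm; have := cP n m nm; rewrite !cE.
  by exists (VFun (lim c1P)) => n; rewrite cE; exact: limP.
Qed.

Definition groundC : cofe :=
  @Cofe (ground L) ground_dist (fun n => (ground_refl n).1) (fun n => (ground_sym n).1)
    (fun n => (ground_trans n).1) (fun m n x y mn => (ground_le mn).1 x y) ground_sep.1
    (fun c => ground_complete.1 _ c erefl).

Definition gvalueC : cofe :=
  @Cofe (gvalue L) gvalue_dist (fun n => (ground_refl n).2) (fun n => (ground_sym n).2)
    (fun n => (ground_trans n).2) (fun m n x y mn => (ground_le mn).2 x y) ground_sep.2
    (fun c => ground_complete.2 _ c erefl).
End GroundCofe.

Lemma ground_map_dist (L M : cofe) n (h h' : L -> M) :
  (forall x y, dist n x y -> dist n (h x) (h' y)) ->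
  (forall a b : groundC L, dist n a b ->
     dist (A := groundC M) n (ground_map h a) (ground_map h' b)) /\
  (forall v w : gvalueC L, dist n v w ->
     dist (A := gvalueC M) n (gvalue_map h v) (gvalue_map h' w)).
Proof.
move=> hh; apply: ground_gvalue_ind.
- by move=> i [].
- by case.
- by move=> i [].
- by move=> v1 I1 v2 I2 [] //= w1 w2 [? ?]; split; [exact: I1|exact: I2].
- by move=> a I [] //= b; exact: I.
- by move=> f [] //= g; exact: hh.
Qed.

Lemma ground_map_id L :
  (forall a : ground L, ground_map id a = a) /\
  (forall v : gvalue L, gvalue_map id v = v).
Proof. by apply: ground_gvalue_ind => //= [v1 -> v2 ->|a ->]. Qed.

Lemma ground_map_comp L M N (h : M -> N) (g : L -> M) :
  (forall a, ground_map (h \o g) a = ground_map h (ground_map g a)) /\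
  (forall v, gvalue_map (h \o g) v = gvalue_map h (gvalue_map g v)).
Proof. by apply: ground_gvalue_ind => //= [v1 -> v2 ->|a ->]. Qed.

(* Contravariant in the first argument, covariant in the second.
   [bifun false]: locally nonexpansive; [bifun true]: locally contractive. *)
Record bifun (c : bool) := Bifun {
  bobj :> cofe -> cofe -> cofe;
  bmap : forall A1 A2 B1 B2 : cofe,
    (A2 -n> A1) -> (B1 -n> B2) -> bobj A1 B1 -n> bobj A2 B2;
  bmap_near : forall (A1 A2 B1 B2 : cofe) n (f f' : A2 -n> A1) (g g' : B1 -n> B2),
    near c n f f' -> near c n g g' -> dist n (bmap f g) (bmap f' g');
  bmap_id : forall A B : cofe, bmap (idN A) (idN B) = idN (bobj A B);
  bmap_comp : forall (A1 A2 A3 B1 B2 B3 : cofe) (f' : A3 -n> A2) (f : A2 -n> A1)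
    (g : B1 -n> B2) (g' : B2 -n> B3),
    bmap (compN f f') (compN g' g) = compN (bmap f' g') (bmap f g)
}.
Arguments bmap {c} _ {A1 A2 B1 B2}.

Definition constF c (C : cofe) : bifun c.
Proof.
by refine (@Bifun c (fun _ _ => C) (fun _ _ _ _ _ _ => idN C) _ _ _) => //;
  move=> *; apply: nemor_eq.
Defined.

Definition idF : bifun false.
Proof.
by refine (@Bifun false (fun _ B => B) (fun _ _ _ _ _ g => g) _ _ _).
Defined.

Definition later_map (A B : cofe) (f : A -n> B) : laterC A -n> laterC B :=
  @NeMor (laterC A) (laterC B) (fun x => Next (f (later_car x)))
    (fun n x y xy m mn => nm_ne f (xy m mn)).

Definition laterF (F : bifun false) : bifun true.
Proof.
refine (@Bifun true (fun A B => laterC (F A B))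
  (fun _ _ _ _ f g => later_map (bmap F f g)) _ _ _).
- by move=> A1 A2 B1 B2 n f f' g g' ff gg [x] m mn /=;
    apply: bmap_near; [exact: ff|exact: gg].
- by move=> A B; apply: nemor_eq => -[x] /=; rewrite bmap_id.
- by move=> *; apply: nemor_eq => -[x] /=; rewrite bmap_comp.
Defined.

Definition prod_map (A A' B B' : cofe) (f : A -n> A') (g : B -n> B') :
    prodC A B -n> prodC A' B' :=
  @NeMor (prodC A B) (prodC A' B') (fun p => (f p.1, g p.2))
    (fun n x y xy => conj (nm_ne f xy.1) (nm_ne g xy.2)).

Definition prodF c (F G : bifun c) : bifun c.
Proof.
refine (@Bifun c (fun A B => prodC (F A B) (G A B))
  (fun _ _ _ _ f g => prod_map (bmap F f g) (bmap G f g)) _ _ _).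
- by move=> A1 A2 B1 B2 n f f' g g' ff gg [x y]; split; apply: bmap_near.
- by move=> A B; apply: nemor_eq => -[x y] /=; rewrite !bmap_id.
- by move=> *; apply: nemor_eq => -[x y] /=; rewrite !bmap_comp.
Defined.

Definition sum_map (A A' B B' : cofe) (f : A -n> A') (g : B -n> B') :
  sumC A B -n> sumC A' B'.
Proof.
refine (@NeMor (sumC A B) (sumC A' B')
  (fun p => match p with inl x => inl (f x) | inr y => inr (g y) end) _).
by move=> n [x|x] [y|y] //=; exact: nm_ne.
Defined.

Definition sumF c (F G : bifun c) : bifun c.
Proof.
refine (@Bifun c (fun A B => sumC (F A B) (G A B))
  (fun _ _ _ _ f g => sum_map (bmap F f g) (bmap G f g)) _ _ _).
- by move=> A1 A2 B1 B2 n f f' g g' ff gg [x|x]; apply: bmap_near.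
- by move=> A B; apply: nemor_eq => -[x|x] /=; rewrite !bmap_id.
- by move=> *; apply: nemor_eq => -[x|x] /=; rewrite !bmap_comp.
Defined.

Definition arrow_map (A A' B B' : cofe) (f : A' -n> A) (g : B -n> B') :
  (A -n> B) -n> (A' -n> B').
Proof.
refine (@NeMor (A -n> B) (A' -n> B') (fun h => compN g (compN h f)) _).
by move=> n h k hk x /=; apply: nm_ne; exact: hk.
Defined.

Definition arrowF c (F G : bifun c) : bifun c.
Proof.
refine (@Bifun c (fun A B => F B A -n> G A B)
  (fun _ _ _ _ f g => arrow_map (bmap F g f) (bmap G f g)) _ _ _).
- move=> A1 A2 B1 B2 n f f' g g' ff gg h x /=.
  by apply: ne_app; [apply: bmap_near|apply: nm_ne; apply: bmap_near].
- by move=> A B; apply: nemor_eq => h; apply: nemor_eq => x /=; rewrite !bmap_id.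
- by move=> *; apply: nemor_eq => h; apply: nemor_eq => x /=; rewrite !bmap_comp.
Defined.

Definition sig_map (I : Type) (A B : I -> cofe) (f : forall i, A i -n> B i) :
  sigC A -n> sigC B.
Proof.
refine (@NeMor (sigC A) (sigC B) (fun p => @inS I B (tag p) (f (tag p) (tagged p))) _).
by move=> n p q /sig_distP[i [x [y [-> -> xy]]]]; exact/nm_ne/nm_ne.
Defined.

Definition sigF c (I : Type) (F : I -> bifun c) : bifun c.
Proof.
refine (@Bifun c (fun A B => sigC (fun i => F i A B))
  (fun _ _ _ _ f g => sig_map (fun i => bmap (F i) f g)) _ _ _).
- by move=> A1 A2 B1 B2 n f f' g g' ff gg [i x]; exists erefl => /=; apply: bmap_near.
- by move=> A B; apply: nemor_eq => -[i x] /=; rewrite !bmap_id.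
- by move=> *; apply: nemor_eq => -[i x] /=; rewrite !bmap_comp.
Defined.

Definition groundF c (F : bifun c) : bifun c.
Proof.
refine (@Bifun c (fun A B => groundC (F A B))
  (fun A1 A2 B1 B2 f g =>
    @NeMor (groundC (F A1 B1)) (groundC (F A2 B2)) (ground_map (bmap F f g))
     (fun n x y => (ground_map_dist (fun _ _ => @nm_ne _ _ (bmap F f g) n _ _)).1 x y))
  _ _ _).
- move=> A1 A2 B1 B2 n f f' g g' ff gg a.
  apply: (ground_map_dist _).1 => // x y; apply: ne_app; exact: bmap_near.
- by move=> A B; apply: nemor_eq => a /=; rewrite bmap_id (ground_map_id _).1.
- by move=> *; apply: nemor_eq => a /=; rewrite bmap_comp -(ground_map_comp _ _).1.
Defined.

Record solution (F : bifun true) := Solution {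
  sol_car : cofe;
  sol_fold : F sol_car sol_car -n> sol_car;
  sol_unfold : sol_car -n> F sol_car sol_car;
  sol_foldK : forall x, sol_unfold (sol_fold x) = x;
  sol_unfoldK : forall x, sol_fold (sol_unfold x) = x
}.

Section Solver.
Variables (F : bifun true) (pt : F unitC unitC).

(* The inverse limit of 1 <- F 1 <- F (F 1) <- ... *)
Fixpoint lvl k : cofe := if k is k.+1 then F (lvl k) (lvl k) else unitC.

Lemma lvl0_eq (x y : lvl 0) : x = y.
Proof. by case: x; case: y. Qed.

Definition toU (A : cofe) : A -n> unitC := @NeMor A unitC (fun=> tt) (fun _ _ _ _ => erefl).
Definition constN (A B : cofe) (b : B) : A -n> B := @NeMor A B (fun=> b) (fun _ _ _ _ => dist_refl _ _).

Fixpoint base k : lvl k :=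
  if k is k.+1 return lvl k then bmap F (toU (lvl k)) (constN unitC (base k)) pt
  else tt.

Fixpoint conv k i : (lvl k -n> lvl i) * (lvl i -n> lvl k) :=
  match k, i return (lvl k -n> lvl i) * (lvl i -n> lvl k) with
  | 0, i => (constN unitC (base i), toU (lvl i))
  | k.+1, 0 => (toU _, constN unitC (base k.+1))
  | k.+1, i.+1 =>
    (bmap F (conv k i).2 (conv k i).1, bmap F (conv k i).1 (conv k i).2)
  end.

Lemma conv_sym k i : (conv k i).2 = (conv i k).1.
Proof.
suff : (conv k i).2 = (conv i k).1 /\ (conv k i).1 = (conv i k).2 by case.
elim: k i => [|k IH] [|i] //=; last by case: (IH i) => -> ->.
Qed.

Definition emb k i : lvl k -n> lvl i := (conv k i).1.

Lemma embSS k i : emb k.+1 i.+1 = bmap F (emb i k) (emb k i).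
Proof. by rewrite /emb /= conv_sym. Qed.

Lemma emb_base j i : emb j i (base j) = base i.
Proof.
elim: j i => [|j IH] [|i] //; rewrite embSS /=.
set b := bmap F (emb i j) (emb j i).
have -> : b (bmap F (toU (lvl j)) (constN unitC (base j)) pt) =
  compN b (bmap F (toU (lvl j)) (constN unitC (base j))) pt by [].
rewrite /b -bmap_comp; congr (nm_fun (bmap F _ _) pt); apply: nemor_eq => //= x.
Qed.

Lemma emb_emb k j i x : minn i k <= j -> emb j i (emb k j x) = emb k i x.
Proof.
suff H : minn i k <= j -> compN (emb j i) (emb k j) = emb k i.
  by move=> /H <-.
elim: j k i {x} => [|j IH] k i.
  rewrite leqn0; case: i => [|i]; first by move=> _; apply: nemor_eq => x; exact: lvl0_eq.
  by case: k => [_|k]; [apply: nemor_eq => -[]|rewrite minnSS].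
case: k i => [|k] [|i] => [_|_|_|].
- by apply: nemor_eq => -[].
- by apply: nemor_eq => -[]; exact: emb_base.
- by apply: nemor_eq.
- rewrite minnSS ltnS => H; have H' : minn k i <= j by rewrite minnC.
  by rewrite !embSS -bmap_comp !IH.
Qed.

Lemma emb_id k x : emb k k x = x.
Proof.
suff -> : emb k k = idN _ by [].
elim: k {x} => [|k IH]; first by apply: nemor_eq => -[].
by rewrite embSS IH bmap_id.
Qed.

Lemma emb_round n j k x : n < j -> dist n (emb j k (emb k j x)) x.
Proof.
suff H : n < j -> dist n (compN (emb j k) (emb k j)) (idN _).
  by move=> /H; exact.
elim: j n k {x} => // j IH n [|k]; first by move=> _ [].
rewrite ltnS => nj; rewrite !embSS -bmap_comp -bmap_id.
by apply: bmap_near => m mn; apply: IH; exact: leq_trans nj.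
Qed.

Record tower := Tower {
  tw :> forall k, lvl k;
  twP : forall k, emb k.+1 k (tw k.+1) = tw k }.

Lemma tower_eq (X Y : tower) : (forall k, X k = Y k) -> X = Y.
Proof.
case: X Y => [X XP] [Y YP] /= XYk.
have XY : X = Y by apply: functional_extensionality_dep.
move: XP YP; rewrite XY => XP YP; congr Tower; exact: Prop_irrelevance.
Qed.

Definition towerC : cofe.
Proof.
refine (@Cofe tower (fun n X Y => forall k, dist n (X k) (Y k)) _ _ _ _ _ _).
- by [].
- by move=> n X Y XY k; exact: dist_sym.
- by move=> n X Y Z XY YZ k; exact: dist_trans (XY k) (YZ k).
- by move=> m n X Y mn XY k; exact: dist_le (XY k).
- by move=> X Y XY; apply: tower_eq => k; apply: dist_eq => n; exact: XY.
- move=> c cP; have cPk k : chain (fun n => c n k) by move=> n m nm; exact: cP.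
  unshelve eexists (@Tower (fun k => lim (cPk k)) _).
    move=> k; apply: dist_eq => n; apply: dist_trans (dist_sym (limP _ n)).
    by rewrite -twP; apply: nm_ne; exact: limP.
  by move=> n k; exact: limP.
Defined.

Lemma tower_emb (X : tower) j i : i <= j -> emb j i (X j) = X i.
Proof.
elim: j => [|j IH]; first by rewrite leqn0 => /eqP->; exact: emb_id.
rewrite leq_eqVlt => /predU1P[->|]; first exact: emb_id.
rewrite ltnS => ij; rewrite -(IH ij) -(twP X j) emb_emb //.
by rewrite geq_min ij.
Qed.

Definition proj k : towerC -n> lvl k :=
  @NeMor towerC (lvl k) (fun X => X k) (fun n X Y XY => XY k).

Definition embed k : lvl k -n> towerC.
Proof.
refine (@NeMor (lvl k) towerC (fun x => @Tower (fun i => emb k i x) _) _).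
- by move=> n x y xy i /=; exact: nm_ne.
Unshelve.
by move=> i; apply: emb_emb; rewrite geq_min leqnSn.
Defined.

Lemma embed_proj k n (X : towerC) : n < k -> dist n (embed k (proj k X)) X.
Proof.
move=> nk i /=; case: (leqP i k) => [ik|/ltnW ki]; first by rewrite tower_emb.
by rewrite -(tower_emb X ki); exact: emb_round.
Qed.

Definition approx (X : towerC) n : F towerC towerC :=
  bmap F (proj n) (embed n) (X n.+1).

Lemma approxP (X : towerC) : chain (approx X).
Proof.
move=> n m nm; rewrite /approx -(tower_emb X (_ : n.+1 <= m.+1)) // embSS.
have -> x : bmap F (proj n) (embed n) (bmap F (emb n m) (emb m n) x) =
  compN (bmap F (proj n) (embed n)) (bmap F (emb n m) (emb m n)) x by [].
rewrite -bmap_comp; apply: bmap_near => p pn; apply: dist_sym.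
- by move=> Y; exact: (embed_proj Y pn m).
- move=> x; exact: (embed_proj (embed m x) pn).
Qed.

Definition unfoldT : towerC -n> F towerC towerC.
Proof.
refine (@NeMor towerC (F towerC towerC) (fun X => lim (approxP X)) _).
move=> n X Y XY; apply: dist_trans (limP _ n) _.
apply: dist_trans (dist_sym (limP _ n)); apply: nm_ne; exact: XY.
Defined.

Definition foldT : F towerC towerC -n> towerC.
Proof.
refine (@NeMor (F towerC towerC) towerC (fun Y => @Tower
  (fun k => if k is k.+1 return lvl k then bmap F (embed k) (proj k) Y else tt) _) _).
- by move=> n x y xy [|k] //=; exact: nm_ne.
Unshelve.
case=> [|k]; first by case: (emb _ _ _).
rewrite embSS.
have -> x : bmap F (emb k k.+1) (emb k.+1 k) (bmap F (embed k.+1) (proj k.+1) x) =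
  compN (bmap F (emb k k.+1) (emb k.+1 k)) (bmap F (embed k.+1) (proj k.+1)) x by [].
rewrite -bmap_comp; congr (nm_fun (bmap F _ _) _); apply: nemor_eq.
- move=> x; apply: tower_eq => i; apply: emb_emb.
  by rewrite geq_min leqnSn orbT.
- by move=> X; exact: twP.
Defined.

Lemma foldTK Y : unfoldT (foldT Y) = Y.
Proof.
apply: dist_eq => n; apply: dist_trans (limP _ n) _; rewrite /approx /=.
have -> : bmap F (proj n) (embed n) (bmap F (embed n) (proj n) Y) =
  compN (bmap F (proj n) (embed n)) (bmap F (embed n) (proj n)) Y by [].
rewrite -bmap_comp -[X in dist n _ X]/(idN _ Y) -bmap_id.
by apply: bmap_near => m mn X; exact: embed_proj.
Qed.

Lemma unfoldTK X : foldT (unfoldT X) = X.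
Proof.
apply: tower_eq => -[|n]; first by case: (tw X 0).
apply: dist_eq => p; set m := maxn p n.
have pm : p <= m by rewrite leq_maxl.
have nm : n <= m by rewrite leq_maxr.
rewrite -(tower_emb X (_ : n.+1 <= m.+1)) // embSS /=.
have -> : bmap F (emb n m) (emb m n) (X m.+1) =
    bmap F (embed n) (proj n) (bmap F (proj m) (embed m) (X m.+1)).
  have -> x : bmap F (embed n) (proj n) (bmap F (proj m) (embed m) x) =
    compN (bmap F (embed n) (proj n)) (bmap F (proj m) (embed m)) x by [].
  rewrite -bmap_comp; congr (nm_fun (bmap F _ _) _); exact: nemor_eq.
by apply: nm_ne; apply: dist_le pm (limP _ m).
Qed.

Lemma solve : solution F.
Proof. exact: Solution foldTK unfoldTK. Qed.
End Solver.

Section GuardedFix.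
Variables (A : cofe) (a0 : A) (f : laterC A -n> A).

Let it n := iter n (fun x => f (Next x)) a0.

Let itP : chain (fun n => it n.+1).
Proof.
elim=> [|n IH] [|m] //= nm; apply: nm_ne => p /= pn //.
by apply: dist_le (IH m nm).
Qed.

Definition gfix : A := lim itP.

Lemma gfixE : gfix = f (Next gfix).
Proof.
apply: dist_eq => n; apply: dist_trans (dist_le (leqnSn n) (limP itP n.+1)) _.
apply: nm_ne => m mn /=; apply: dist_sym; apply: dist_trans (limP itP m) _.
by apply: dist_sym; apply: (itP (ltnW mn)).
Qed.
End GuardedFix.

Notation "'λne' x .. y , t" :=
  (@NeMor _ _ (fun x => .. (@NeMor _ _ (fun y => t) _) ..) _)
  (at level 200, x binder, y binder, right associativity, only parsing).

Lemma ne_lam (A B : cofe) n (f g : A -> B) fP gP :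
  (forall x, dist n (f x) (g x)) ->
  dist (A := A -n> B) n (NeMor f fP) (NeMor g gP).
Proof. exact. Qed.

Lemma dfun_lam T (A : cofe) n (f g : T -> A) :
  (forall x, dist n (f x) (g x)) -> dist (A := dfunC T A) n f g.
Proof. exact. Qed.

Ltac solve_ne_step :=
  match goal with
  | |- dist _ ?x ?x => exact: dist_refl
  | H : dist ?n ?x ?y |- dist ?n ?x ?y => exact: H
  | |- dist _ (NeMor _ _) (NeMor _ _) => apply: ne_lam => ?; cbv beta
  | |- dist _ (nm_fun ?f ?x) (nm_fun ?g ?y) => apply: (@ne_app _ _ _ f g x y)
  | |- dist _ (fun _ => _) (fun _ => _) => apply: dfun_lam => ?; cbv beta
  end.
Ltac solve_ne := intros; cbv beta; repeat solve_ne_step.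
#[local] Obligation Tactic := try solve [solve_ne].
#[local] Unset Program Cases.

Definition inlN (A B : cofe) : A -n> sumC A B :=
  @NeMor A (sumC A B) inl (fun _ _ _ xy => xy).
Definition inrN (A B : cofe) : B -n> sumC A B :=
  @NeMor B (sumC A B) inr (fun _ _ _ xy => xy).
Definition pairN (A B : cofe) : A -n> B -n> prodC A B.
Proof.
refine (@NeMor A (B -n> prodC A B)
  (fun x => @NeMor B (prodC A B) (pair x) _) _).
- by move=> n x x' xx y; split.
Unshelve. by move=> n y y' yy; split.
Defined.

(* Functorial action of later, applied to a delayed function. *)
Definition lap (A B : cofe) : laterC (A -n> B) -n> laterC A -n> laterC B.
Proof.
refine (@NeMor (laterC (A -n> B)) (laterC A -n> laterC B) (fun f =>
  @NeMor (laterC A) (laterC B) (fun x => Next (later_car f (later_car x))) _) _).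
- by move=> n f g fg x m mn /=; exact: (fg m mn).
Unshelve. by move=> n x y xy m mn /=; apply: nm_ne; exact: xy.
Defined.

Record signature := Signature {
  op : Type;
  Ins : op -> bifun true;
  Outs : op -> bifun true
}.

Inductive error := RunTime | Lin.

Definition funF : bifun true := laterF (arrowF idF idF).

(* IT = ground + later (IT -> IT) + error + later IT
        + sum_i Ins_i(IT) * (Outs_i(IT) -> later IT) *)
Definition itF (E : signature) : bifun true :=
  sumF (groundF funF)
  (sumF funF
  (sumF (constF true (discC error))
  (sumF (laterF idF)
        (sigF (fun i : op E => prodF (Ins i) (arrowF (Outs i) (laterF idF))))))).

Section IT.
Variable E : signature.

Definition IT_sol : solution (itF E) :=
  solve (inr (inr (inl RunTime)) : itF E unitC unitC).
Definition IT : cofe := sol_car IT_sol.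

Definition funIT : cofe := laterC (IT -n> IT).
Definition groundIT : cofe := groundC funIT.
Definition ITV : cofe := gvalueC funIT.
Definition visIT (i : op E) : cofe := prodC (Ins i IT IT) (Outs i IT IT -n> laterC IT).
Definition itT : cofe :=
  sumC groundIT (sumC funIT (sumC (discC error) (sumC (laterC IT) (sigC visIT)))).

#[global] Strategy 1000 [sumC prodC neC laterC groundC gvalueC sigC discC dfunC].
#[global] Strategy expand [bobj itF sumF groundF laterF arrowF idF constF sigF prodF funF].
Definition fold_IT : itT -n> IT := sol_fold IT_sol.
Definition unfold_IT : IT -n> itT := sol_unfold IT_sol.

Lemma fold_ITK x : unfold_IT (fold_IT x) = x.
Proof. exact: (sol_foldK (s := IT_sol)). Qed.

Lemma unfold_ITK x : fold_IT (unfold_IT x) = x.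
Proof. exact: (sol_unfoldK (s := IT_sol)). Qed.

Definition Ret : groundIT -n> IT := compN fold_IT (inlN _ _).
Definition Fun : funIT -n> IT :=
  compN fold_IT (compN (inrN _ _) (inlN _ _)).
Definition Err : discC error -n> IT :=
  compN fold_IT (compN (inrN _ _) (compN (inrN _ _) (inlN _ _))).
Definition Tau : laterC IT -n> IT :=
  compN fold_IT (compN (inrN _ _) (compN (inrN _ _) (compN (inrN _ _) (inlN _ _)))).
Program Definition Vis (i : op E) :
    Ins i IT IT -n> (Outs i IT IT -n> laterC IT) -n> IT :=
  λne x k,
    fold_IT (inrN _ _ (inrN _ _ (inrN _ _ (inrN _ _ (inS visIT i (pairN _ _ x k)))))).


Definition Tick : IT -n> IT := compN Tau (NextN IT).

Definition of_val (v : ITV) : IT :=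
  match v with VRet a => Ret a | VFun f => Fun f end.

Definition is_value (α : IT) : Prop :=
  (exists a, α = Ret a) \/ (exists f, α = Fun f).

(* The homomorphic extension of h, where r is the recursive call. *)
Definition bind_case (r : funIT) (h : ITV -n> IT) (z : itT) : IT :=
  match z with
  | inl a => h (VRet a)
  | inr (inl f) => h (VFun f)
  | inr (inr (inl e)) => Err e
  | inr (inr (inr (inl t))) => Tau (lap _ _ r t)
  | inr (inr (inr (inr p))) =>
      Vis (tag p) (tagged p).1 (compN (lap _ _ r) (tagged p).2)
  end.

Lemma bind_case_ne n (r r' : funIT) (h h' : ITV -n> IT) (z z' : itT) :
  dist n r r' -> dist n h h' -> dist n z z' ->
  dist n (bind_case r h z) (bind_case r' h' z').
Proof.
move=> rr hh; case: z z' => [a|[f|[e|[t|p]]]] [b|[g|[e'|[t'|p']]]] //= zz.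
- exact: ne_app.
- exact: ne_app.
- by rewrite zz.
- by apply: (nm_ne (Tau)); apply: (ne_app (nm_ne (lap _ _) rr)).
- case: (sig_distP zz) => i [x [y [-> -> [xy1 xy2]]]] /=.
  apply: (ne_app (nm_ne (Vis i) xy1)) => w /=.
  by apply: (ne_app (nm_ne (lap _ _) rr)); exact: xy2.
Qed.

Definition at_arg (A B : cofe) (a : A) : (A -n> B) -n> B :=
  @NeMor (A -n> B) B (fun b => b a) (fun _ _ _ bb => bb a).

Definition bind_body :
  laterC ((ITV -n> IT) -n> IT -n> IT) -n> (ITV -n> IT) -n> IT -n> IT.
Proof.
unshelve refine (NeMor (fun self => NeMor (fun h => NeMor (fun α =>
  bind_case (later_map (at_arg _ h) self) h (unfold_IT α)) _) _) _).
- by move=> n α α' aa; apply: bind_case_ne => //; exact: nm_ne.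
- move=> n h h' hh; apply: ne_lam => α; apply: bind_case_ne => //.
  by move=> m mn /=; apply: nm_ne; apply: dist_le hh; exact: ltnW.
- move=> n self self' ss; do 2!apply: ne_lam => ?; apply: bind_case_ne => //.
  by move=> m mn /=; exact: (ss m mn).
Defined.

Definition bind : (ITV -n> IT) -n> IT -n> IT :=
  gfix (constN _ (idN IT)) bind_body.

Lemma bind_Ret h a : bind h (Ret a) = h (VRet a).
Proof. by rewrite /bind gfixE /= fold_ITK. Qed.

Lemma bind_Fun h f : bind h (Fun f) = h (VFun f).
Proof. by rewrite /bind gfixE /= fold_ITK. Qed.

Lemma bind_Err h e : bind h (Err e) = Err e.
Proof. by rewrite /bind gfixE /= fold_ITK. Qed.

Lemma bind_Tau h t : bind h (Tau t) = Tau (later_map (bind h) t).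
Proof. by rewrite {1}/bind gfixE /= fold_ITK. Qed.

Lemma bind_Vis h i x k :
  bind h (Vis i x k) = Vis i x (compN (later_map (bind h)) k).
Proof.
by rewrite {1}/bind gfixE [LHS]/= fold_ITK.
Qed.

(* [getval α f] and [getret α f] run α and pass the resulting value, resp. the
   resulting ground value, to f; getret, getfun, ... fail with RunTime on
   values of another shape. *)
Program Definition of_valN : ITV -n> IT := NeMor of_val _.
Next Obligation. by move=> n [a|f] [b|g] //= xy; exact: nm_ne. Qed.

Program Definition getval : IT -n> (IT -n> IT) -n> IT :=
  λne α f, bind (compN f of_valN) α.
Next Obligation. by move=> α n f g fg; solve_ne => v; exact: fg. Qed.

Program Definition ret_case : (groundIT -n> IT) -n> ITV -n> IT :=
  λne f v, match v with VRet a => f a | VFun _ => Err RunTime end.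
Next Obligation. by move=> f n [a|g] [b|g'] //= ab; exact: nm_ne. Qed.
Next Obligation. by move=> n f g fg; apply: ne_lam => -[a|h] //; exact: fg. Qed.

Program Definition fun_case : (funIT -n> IT) -n> ITV -n> IT :=
  λne f v, match v with VRet _ => Err RunTime | VFun g => f g end.
Next Obligation. by move=> f n [a|g] [b|g'] //= ab; exact: nm_ne. Qed.
Next Obligation. by move=> n f g fg; apply: ne_lam => -[a|h] //; exact: fg. Qed.

Program Definition getret : IT -n> (groundIT -n> IT) -n> IT :=
  λne α f, bind (ret_case f) α.

Program Definition getfun : IT -n> (funIT -n> IT) -n> IT :=
  λne α f, bind (fun_case f) α.

Program Definition nat_case : dfunC nat IT -n> groundIT -n> IT :=
  λne f a, match a with GNat m => f m | _ => Err RunTime end.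
Next Obligation. by move=> f n [i||i|v w] [j||j|v' w'] //= ->. Qed.
Next Obligation.
by move=> n f g fg; apply: ne_lam => -[i||i|v w] //; exact: fg.
Qed.

Program Definition loc_case : dfunC loc IT -n> groundIT -n> IT :=
  λne f a, match a with GLoc l => f l | _ => Err RunTime end.
Next Obligation. by move=> f n [i||i|v w] [j||j|v' w'] //= ->. Qed.
Next Obligation.
by move=> n f g fg; apply: ne_lam => -[i||i|v w] //; exact: fg.
Qed.

Program Definition fst_case : groundIT -n> IT :=
  λne a, match a with GPair v _ => of_val v | _ => Err RunTime end.
Next Obligation.
by move=> n [i||i|v w] [j||j|v' w'] //= [vv _]; exact: (nm_ne of_valN).
Qed.

Program Definition snd_case : groundIT -n> IT :=
  λne a, match a with GPair _ v => of_val v | _ => Err RunTime end.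
Next Obligation.
by move=> n [i||i|v w] [j||j|v' w'] //= [_ ww]; exact: (nm_ne of_valN).
Qed.

Program Definition getloc : IT -n> dfunC loc IT -n> IT :=
  λne α f, getret α (loc_case f).

Program Definition IF : IT -n> IT -n> IT -n> IT :=
  λne α β γ,
    getret α (nat_case (fun n => if n != 0 then β else γ)).
Next Obligation. by move=> α β n γ γ' gg; solve_ne; case: ifP. Qed.
Next Obligation. by move=> α n β β' bb; solve_ne; case: ifP. Qed.

(* The argument is evaluated to a value before the function. *)
Program Definition APP : IT -n> IT -n> IT :=
  λne α β, getval β (λne v, getfun α (λne g, Tau (lap _ _ g (NextN _ v)))).

Program Definition GPairN : ITV -n> ITV -n> groundIT :=
  λne v w, GPair v w.
Next Obligation. by move=> v n w w' ww /=; split => //; exact: dist_refl. Qed.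
Next Obligation. by move=> n v v' vv w /=; split => //; exact: dist_refl. Qed.

Program Definition PAIR : IT -n> IT -n> IT :=
  λne α β, bind (λne w, bind (λne v, Ret (GPairN v w)) α) β.

Program Definition FST : IT -n> IT := λne α, getret α fst_case.
Program Definition SND : IT -n> IT := λne α, getret α snd_case.
End IT.

Arguments Ret {E}.
Arguments Fun {E}.
Arguments Err {E}.
Arguments Tau {E}.
Arguments Vis {E} i.
Arguments Tick {E}.
Arguments bind {E}.
Arguments getval {E}.
Arguments getret {E}.
Arguments getfun {E}.
Arguments nat_case {E}.
Arguments loc_case {E}.
Arguments getloc {E}.
Arguments IF {E}.
Arguments APP {E}.
Arguments PAIR {E}.
Arguments FST {E}.
Arguments SND {E}.

Notation "'LET' x ':=' a 'IN' b" := (getval a (λne x, b))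
  (at level 200, x name, a at level 100, b at level 200, only parsing).

Inductive aff_op := op_alloc | op_dealloc | op_atomic | op_fork.

Definition aff_Ins (i : aff_op) : bifun true :=
  match i with
  | op_alloc => laterF idF
  | op_dealloc => constF true (discC loc)
  | op_atomic =>
      prodF (constF true (discC loc)) (laterF (arrowF idF (prodF idF idF)))
  | op_fork => laterF idF
  end.

Definition aff_Outs (i : aff_op) : bifun true :=
  match i with
  | op_alloc => constF true (discC loc)
  | op_dealloc => constF true unitC
  | op_atomic => laterF idF
  | op_fork => constF true unitC
  end.

Definition affE : signature := Signature aff_Ins aff_Outs.
Notation ITa := (IT affE).

Definition heap : Type := {fmap loc -> later ITa}.

(* Only the underlying functions of the reifiers matter for reduction, so they
   are not bundled as nonexpansive maps.  [fresh] chooses the location of a new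
   cell from the domain of the heap.  Deallocation of a location that is not in
   the heap is stuck, as is an atomic access to it. *)
Definition reify (fresh : {fset loc} -> loc) (i : op affE) :
    Ins i ITa ITa -> heap -> (Outs i ITa ITa -n> laterC ITa) ->
    option (later ITa * heap * seq (later ITa)) :=
  match i return
    Ins (s := affE) i ITa ITa -> heap ->
    (Outs (s := affE) i ITa ITa -n> laterC ITa) ->
    option (later ITa * heap * seq (later ITa))
  with
  | op_alloc => fun v σ κ =>
      let l := fresh (domf σ) in Some (κ l, σ.[l <- v]%fmap, [::])
  | op_dealloc => fun l σ κ =>
      if σ.[? l]%fmap is Some _ then Some (κ tt, σ.[~ l]%fmap, [::]) else None
  | op_atomic => fun lf σ κ =>
      if σ.[? lf.1]%fmap is Some v then
        let p := later_car lf.2 (later_car v) in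
        Some (κ (Next p.1), σ.[lf.1 <- Next p.2]%fmap, [::])
      else None
  | op_fork => fun e σ κ => Some (κ tt, σ, [:: e])
  end.

Inductive step fresh (α : ITa) (σ : heap) (β : ITa) (σ' : heap) (l : seq ITa) : Prop :=
  | step_tick of α = Tick β & σ' = σ & l = [::]
  | step_vis (i : op affE) (x : Ins i ITa ITa) (k : Outs i ITa ITa -n> laterC ITa)
      (l' : seq (later ITa)) of
      α = Vis i x k &
      reify fresh x σ k = Some (Next β, σ', l') &
      l = [seq later_car t | t <- l'].

Definition config : Type := seq ITa * heap.

Definition tp_step fresh (c c' : config) : Prop :=
  exists (i : nat) (β : ITa) (l : seq ITa),
    [/\ i < size c.1,
        step fresh (nth (Err RunTime) c.1 i) c.2 β c'.2 l &
        c'.1 = set_nth (Err RunTime) c.1 i β ++ l].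

Definition tp_steps fresh : config -> config -> Prop :=
  clos_refl_trans_1n config (tp_step fresh).

Program Definition ALLOC : ITa -n> dfunC loc ITa -n> ITa :=
  λne α k, Vis (op_alloc : op affE) (NextN ITa α)
    (@NeMor (discC loc) (laterC ITa) (fun l => NextN ITa (k l)) _).
Next Obligation. by move=> α k n l l' ->. Qed.
Next Obligation.
by move=> α n k k' kk; solve_ne; exact: kk.
Qed.

Definition DEALLOC (l : loc) : ITa :=
  Vis (op_dealloc : op affE) l
    (@NeMor unitC (laterC ITa) (fun=> Next (Ret GUnit)) (fun _ _ _ _ => dist_refl _ _)).

Program Definition XCHG (l : loc) : ITa -n> ITa :=
  λne w, Vis (op_atomic : op affE)
    (pairN (discC loc) (laterC (ITa -n> prodC ITa ITa)) l
       (NextN (ITa -n> prodC ITa ITa) (λne x, pairN ITa ITa x w)))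
    (idN (laterC ITa)).

Definition FORK : ITa -n> ITa :=
  compN (at_arg _ (@NeMor unitC (laterC ITa)
           (fun=> Next (Ret GUnit)) (fun _ _ _ _ => dist_refl _ _)))
    (compN (Vis (op_fork : op affE)) (NextN ITa)).

Program Definition Thunk : ITa -n> ITa :=
  λne α, ALLOC (Ret (GNat 0)) (fun l =>
    Fun (NextN (ITa -n> ITa) (λne _,
      IF (XCHG l (Ret (GNat 1))) (Err Lin) α))).

Program Definition Force : ITa -n> ITa := λne α, APP α (Ret (GNat 0)).

Definition var := nat.

Inductive ty :=
  | TBool | TNat | TUnit
  | TTensor (τ1 τ2 : ty)
  | TLolli (τ1 τ2 : ty)
  | TRef (τ : ty).

Inductive expr :=
  | ENat (n : nat)
  | EBool (b : bool)
  | EUnit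
  | EVar (x : var)
  | ELam (x : var) (e : expr)
  | EApp (e1 e2 : expr)
  | EPair (e1 e2 : expr)
  | ELetPair (x1 x2 : var) (e1 e2 : expr)
  | EAlloc (e : expr)
  | EDealloc (e : expr)
  | EReplace (e1 e2 : expr)
  | EFork (e1 e2 : expr).

(* Typing contexts are finite maps.  A binder shadows, hence the update
   Γ.[x <- τ], which agrees with the update of environments in [interp]; the
   splitting Γ1, Γ2 is the union of maps with disjoint domains. *)
Definition ctx : Type := {fmap var -> ty}.

Definition splits (Γ Γ1 Γ2 : ctx) : Prop :=
  [disjoint domf Γ1 & domf Γ2]%fset /\ Γ = (Γ1 + Γ2)%fset.

Inductive typed : ctx -> expr -> ty -> Prop :=
  | ty_bool Γ b : typed Γ (EBool b) TBool
  | ty_nat Γ n : typed Γ (ENat n) TNat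
  | ty_unit Γ : typed Γ EUnit TUnit
  | ty_var (Γ : ctx) x τ : Γ.[? x]%fmap = Some τ -> typed Γ (EVar x) τ
  | ty_lam (Γ : ctx) x e τ1 τ2 :
      typed Γ.[x <- τ1]%fmap e τ2 -> typed Γ (ELam x e) (TLolli τ1 τ2)
  | ty_app Γ Γ1 Γ2 e1 e2 τ1 τ2 :
      splits Γ Γ1 Γ2 ->
      typed Γ1 e1 (TLolli τ1 τ2) -> typed Γ2 e2 τ1 ->
      typed Γ (EApp e1 e2) τ2
  | ty_pair Γ Γ1 Γ2 e1 e2 τ1 τ2 :
      splits Γ Γ1 Γ2 ->
      typed Γ1 e1 τ1 -> typed Γ2 e2 τ2 ->
      typed Γ (EPair e1 e2) (TTensor τ1 τ2)
  | ty_letpair (Γ Γ1 Γ2 : ctx) x1 x2 e1 e2 τ1 τ2 τ :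
      splits Γ Γ1 Γ2 ->
      typed Γ1 e1 (TTensor τ1 τ2) ->
      typed Γ2.[x1 <- τ1].[x2 <- τ2]%fmap e2 τ ->
      typed Γ (ELetPair x1 x2 e1 e2) τ
  | ty_alloc Γ e τ : typed Γ e τ -> typed Γ (EAlloc e) (TRef τ)
  | ty_dealloc Γ e τ : typed Γ e (TRef τ) -> typed Γ (EDealloc e) TUnit
  | ty_replace Γ Γ1 Γ2 e1 e2 τ1 τ2 :
      splits Γ Γ1 Γ2 ->
      typed Γ1 e1 (TRef τ1) -> typed Γ2 e2 τ2 ->
      typed Γ (EReplace e1 e2) (TTensor τ1 (TRef τ2))
  | ty_fork Γ Γ1 Γ2 e1 e2 τ :
      splits Γ Γ1 Γ2 ->
      typed Γ1 e1 TUnit -> typed Γ2 e2 τ ->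
      typed Γ (EFork e1 e2) τ.

Definition env : cofe := dfunC var ITa.
Definition empty_env : env := fun=> Err RunTime.

Definition lookup (x : var) : env -n> ITa :=
  @NeMor env ITa (fun ρ => ρ x) (fun _ _ _ rr => rr x).

Program Definition upd (x : var) : env -n> ITa -n> env :=
  λne ρ α, fun y => if y == x then α else ρ y.
Next Obligation. by move=> x ρ n α α' aa y; case: ifP. Qed.
Next Obligation.
by move=> x n ρ ρ' rr; apply: ne_lam => α y; case: ifP => // _; exact: rr.
Qed.

Program Definition interp_lam (x : var) (e : env -n> ITa) : env -n> ITa :=
  λne ρ, Fun (NextN (ITa -n> ITa) (λne α, e (upd x ρ α))).

Program Definition interp_app (e1 e2 : env -n> ITa) : env -n> ITa :=
  λne ρ, LET x := e2 ρ IN APP (e1 ρ) (Thunk x).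

Program Definition interp_pair (e1 e2 : env -n> ITa) : env -n> ITa :=
  λne ρ, PAIR (e1 ρ) (e2 ρ).

Program Definition interp_letpair (x1 x2 : var) (e1 e2 : env -n> ITa) : env -n> ITa :=
  λne ρ,
    LET x := e1 ρ IN
    LET y := Thunk (FST x) IN
    LET z := Thunk (SND x) IN
    e2 (upd x2 (upd x1 ρ y) z).

Program Definition interp_alloc (e : env -n> ITa) : env -n> ITa :=
  λne ρ, LET x := e ρ IN ALLOC x (fun l => Ret (GLoc l)).

Program Definition interp_dealloc (e : env -n> ITa) : env -n> ITa :=
  λne ρ, getloc (e ρ) DEALLOC.

Program Definition interp_replace (e1 e2 : env -n> ITa) : env -n> ITa :=
  λne ρ,
    LET y := e2 ρ IN
    getloc (e1 ρ) (fun l =>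
      LET x := XCHG l y IN PAIR x (Ret (GLoc l))).

Program Definition interp_fork (e1 e2 : env -n> ITa) : env -n> ITa :=
  λne ρ, LET _ := FORK (e1 ρ) IN e2 ρ.

(* Environments are total, undefined variables being mapped to an error.  The
   subterms of a typed term are interpreted in the whole of ρ rather than in
   its restrictions to Γ1 and Γ2: see [interp_restrict]. *)
Fixpoint interp (e : expr) : env -n> ITa :=
  match e with
  | ENat n => constN env (Ret (GNat n))
  | EBool b => constN env (Ret (GNat (if b then 1 else 0)))
  | EUnit => constN env (Ret GUnit)
  | EVar x => compN Force (lookup x)
  | ELam x e => interp_lam x (interp e)
  | EApp e1 e2 => interp_app (interp e1) (interp e2)
  | EPair e1 e2 => interp_pair (interp e1) (interp e2)
  | ELetPair x1 x2 e1 e2 => interp_letpair x1 x2 (interp e1) (interp e2)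
  | EAlloc e => interp_alloc (interp e)
  | EDealloc e => interp_dealloc (interp e)
  | EReplace e1 e2 => interp_replace (interp e1) (interp e2)
  | EFork e1 e2 => interp_fork (interp e1) (interp e2)
  end.

Lemma interp_restrict Γ e τ (ρ ρ' : env) :
  typed Γ e τ -> (forall x, x \in Γ -> ρ x = ρ' x) ->
  interp e ρ = interp e ρ'.
Proof.
have updE (Δ : ctx) x σ (r r' : env) (α : ITa) :
    (forall y, y \in Δ -> r y = r' y) ->
    forall y, y \in Δ.[x <- σ]%fmap -> upd x r α y = upd x r' α y.
  move=> rr y; rewrite /upd /= mem_setf inE; case: eqP => //= _; exact: rr.
have splitL (Δ Δ1 Δ2 : ctx) (r r' : env) : splits Δ Δ1 Δ2 ->
    (forall y, y \in Δ -> r y = r' y) -> forall y, y \in Δ1 -> r y = r' y.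
  by case=> _ -> rr y y1; apply: rr; rewrite mem_catf y1.
have splitR (Δ Δ1 Δ2 : ctx) (r r' : env) : splits Δ Δ1 Δ2 ->
    (forall y, y \in Δ -> r y = r' y) -> forall y, y \in Δ2 -> r y = r' y.
  by case=> _ -> rr y y2; apply: rr; rewrite mem_catf y2 orbT.
move=> De; elim: De ρ ρ' => {Γ e τ} //=.
- by move=> Γ x τ Gx ρ ρ' rr; rewrite rr // -fndSome Gx.
- move=> Γ x e τ1 τ2 _ IH ρ ρ' rr; congr (Fun (Next _)).
  by apply: nemor_eq => α /=; apply: IH; exact: updE.
- move=> Γ Γ1 Γ2 e1 e2 τ1 τ2 sp _ I1 _ I2 ρ ρ' rr.
  rewrite (I2 _ _ (splitR _ _ _ _ _ sp rr)); congr (nm_fun (getval _) _).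
  by apply: nemor_eq => x /=; rewrite (I1 _ _ (splitL _ _ _ _ _ sp rr)).
- move=> Γ Γ1 Γ2 e1 e2 τ1 τ2 sp _ I1 _ I2 ρ ρ' rr.
  by rewrite (I1 _ _ (splitL _ _ _ _ _ sp rr)) (I2 _ _ (splitR _ _ _ _ _ sp rr)).
- move=> Γ Γ1 Γ2 x1 x2 e1 e2 τ1 τ2 τ sp _ I1 _ I2 ρ ρ' rr.
  rewrite (I1 _ _ (splitL _ _ _ _ _ sp rr)); congr (nm_fun (getval _) _).
  apply: nemor_eq => x /=; congr (nm_fun (getval _) _).
  apply: nemor_eq => y /=; congr (nm_fun (getval _) _).
  by apply: nemor_eq => z /=; apply: I2; apply/updE/updE; exact: (splitR _ _ _ _ _ sp rr).
- by move=> Γ e τ _ IH ρ ρ' rr; rewrite (IH _ _ rr).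
- by move=> Γ e τ _ IH ρ ρ' rr; rewrite (IH _ _ rr).
- move=> Γ Γ1 Γ2 e1 e2 τ1 τ2 sp _ I1 _ I2 ρ ρ' rr.
  rewrite (I2 _ _ (splitR _ _ _ _ _ sp rr)); congr (nm_fun (getval _) _).
  by apply: nemor_eq => y /=; rewrite (I1 _ _ (splitL _ _ _ _ _ sp rr)).
- move=> Γ Γ1 Γ2 e1 e2 τ sp _ I1 _ I2 ρ ρ' rr.
  rewrite (I1 _ _ (splitL _ _ _ _ _ sp rr)); congr (nm_fun (getval _) _).
  by apply: nemor_eq => y /=; rewrite (I2 _ _ (splitR _ _ _ _ _ sp rr)).
Qed.

(* Main.v *)
Require Import Defs.
From HB Require Import structures.
From mathcomp Require Import all_boot finmap boolp.

Set Implicit Arguments.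
Unset Strict Implicit.
Unset Printing Implicit Defensive.

(** Threads never share memory: a fork hands part of the parent's cells over to
    the child, and every later access is to a cell owned by the accessing thread.
    Hence a thread is safe relative to the partial heap it owns ([safe]), without
    any invariant on shared state, and types can be interpreted by recursion on
    their structure as predicates on values and owned partial heaps ([valid]): a
    reference owns its cell and what its content owns, and a thunk owns its flag,
    still set to 0, and what its value owns.  Typed terms are safe in
    environments of thunks owning disjoint partial heaps, and a pool of safe
    threads owning disjoint parts of the heap is preserved by reduction. *)

(** * Partial heaps *)

(** Owned memory is a partial function and not a finite map, so that a part can be cut out by any
    classical predicate, as [env_valid_split] does. *)
Definition pheap := loc -> option (later ITa).

Definition ph_empty : pheap := fun=> None.
Definition ph_set (h : pheap) l (c : option (later ITa)) : pheap :=
  fun l' => if l' == l then c else h l'.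
Definition ph_diff (h h1 : pheap) : pheap := fun l => if h1 l then None else h l.
Definition ph_sub (h1 h2 : pheap) := forall l c, h1 l = Some c -> h2 l = Some c.
Definition ph_disj (h1 h2 : pheap) := forall l, h1 l = None \/ h2 l = None.

Lemma ph_sub_refl h : ph_sub h h. Proof. by []. Qed.
#[local] Hint Resolve ph_sub_refl : core.

Lemma ph_sub_empty h : ph_sub ph_empty h. Proof. by []. Qed.
#[local] Hint Resolve ph_sub_empty : core.

Lemma ph_disj_empty h : ph_disj h ph_empty. Proof. by right. Qed.
#[local] Hint Resolve ph_disj_empty : core.

Lemma ph_empty_disj h : ph_disj ph_empty h. Proof. by left. Qed.
#[local] Hint Resolve ph_empty_disj : core.

Lemma ph_sub_trans h1 h2 h3 : ph_sub h1 h2 -> ph_sub h2 h3 -> ph_sub h1 h3.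
Proof. by move=> s12 s23 l c /s12/s23. Qed.

Lemma ph_disj_sym h1 h2 : ph_disj h1 h2 -> ph_disj h2 h1.
Proof. by move=> d l; case: (d l); [right|left]. Qed.

Lemma ph_sub_None h1 h2 l : ph_sub h1 h2 -> h2 l = None -> h1 l = None.
Proof. by move=> s h2l; case E: (h1 l) => [c|] //; move/s: E; rewrite h2l. Qed.

Lemma ph_disj_sub h1 h2 h1' h2' :
  ph_disj h1 h2 -> ph_sub h1' h1 -> ph_sub h2' h2 -> ph_disj h1' h2'.
Proof.
by move=> d s1 s2 l; case: (d l) => [/(ph_sub_None s1)|/(ph_sub_None s2)]; [left|right].
Qed.

Lemma ph_disj_Some h1 h2 l c : ph_disj h1 h2 -> h1 l = Some c -> h2 l = None.
Proof. by move=> d h1l; case: (d l) => //; rewrite h1l. Qed.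

Lemma ph_set_same h l c : ph_set h l c l = c.
Proof. by rewrite /ph_set eqxx. Qed.

Lemma ph_sub_set h1 h2 l c : ph_sub h1 h2 -> ph_sub (ph_set h1 l c) (ph_set h2 l c).
Proof. by move=> s l' c'; rewrite /ph_set; case: eqP => // _; exact: s. Qed.

Lemma ph_sub_setr h1 h2 l c : h1 l = None -> ph_sub h1 h2 -> ph_sub h1 (ph_set h2 l c).
Proof.
move=> h1l s l' c' h1l'; rewrite /ph_set; case: eqP => [ll|_]; last exact: s.
by move: h1l'; rewrite ll h1l.
Qed.

Lemma ph_disj_set h1 h2 l c :
  ph_disj h1 h2 -> h2 l = None -> ph_disj (ph_set h1 l c) h2.
Proof. by move=> d h2l l'; rewrite /ph_set; case: eqP => [->|_]; [right|]. Qed.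

Lemma ph_sub_diff h1 h2 h : ph_sub h1 h2 -> ph_sub (ph_diff h1 h) (ph_diff h2 h).
Proof. by move=> s l c; rewrite /ph_diff; case: (h l) => // /s. Qed.

Lemma ph_sub_diffr h1 h2 h : ph_disj h1 h -> ph_sub h1 h2 -> ph_sub h1 (ph_diff h2 h).
Proof. by move=> d s l c hl; rewrite /ph_diff (ph_disj_Some d hl) (s _ _ hl). Qed.

Lemma ph_diff_sub h1 h2 : ph_sub (ph_diff h1 h2) h1.
Proof. by move=> l c; rewrite /ph_diff; case: (h2 l). Qed.

Lemma ph_disj_diff h1 h2 : ph_disj (ph_diff h1 h2) h2.
Proof. by move=> l; rewrite /ph_diff; case: (h2 l); [left|right]. Qed.

(** * Safe threads *)

Definition post := ITV affE -> pheap -> Prop.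

Definition alloc_op : op affE := op_alloc.
Definition dealloc_op : op affE := op_dealloc.
Definition atomic_op : op affE := op_atomic.
Definition fork_op : op affE := op_fork.

(* [safe n Φ α h]: with [h] as its own memory, [α] runs for [n] steps without
   getting stuck, and if it reaches a value [v] by then, it owns enough for [Φ v]. *)
Inductive safe : nat -> post -> ITa -> pheap -> Prop :=
  | safe_0 Φ α h : safe 0 Φ α h
  | safe_val n (Φ : post) v h0 h :
      Φ v h0 -> ph_sub h0 h -> safe n.+1 Φ (of_val v) h
  | safe_tick n Φ β h : safe n Φ β h -> safe n.+1 Φ (Tick β) h
  | safe_alloc n Φ (x : later ITa) (k : discC loc -n> laterC ITa) (h : pheap) :
      (forall l, h l = None ->
        safe n Φ (later_car (k l)) (ph_set h l (Some x))) ->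
      safe n.+1 Φ (Vis alloc_op x k) h
  | safe_dealloc n Φ (l : loc) (k : unitC -n> laterC ITa) (h : pheap) c :
      h l = Some c -> safe n Φ (later_car (k tt)) (ph_set h l None) ->
      safe n.+1 Φ (Vis dealloc_op l k) h
  | safe_atomic n Φ (l : loc) (f : laterC (ITa -n> prodC ITa ITa))
      (k : laterC ITa -n> laterC ITa) (h : pheap) c :
      h l = Some c ->
      safe n Φ (later_car (k (Next (later_car f (later_car c)).1)))
        (ph_set h l (Some (Next (later_car f (later_car c)).2))) ->
      safe n.+1 Φ (Vis atomic_op (l, f) k) h
  | safe_fork n Φ Ψ (t : later ITa) (k : unitC -n> laterC ITa) (h h1 : pheap) :
      ph_sub h1 h -> safe n Ψ (later_car t) h1 ->
      safe n Φ (later_car (k tt)) (ph_diff h h1) ->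
      safe n.+1 Φ (Vis fork_op t k) h.

(** Serves the threads that stand still while another one steps: the index counts the steps of the
    whole pool. *)
Lemma safe_pred n Φ α h : safe n.+1 Φ α h -> safe n Φ α h.
Proof.
elim: n Φ α h => [|n IH] Φ α h sα; first exact: safe_0.
move Em : n.+2 sα => m sα; case: sα Em => {m Φ α h} //.
- by move=> m Φ v h0 h Φv s _; exact: safe_val Φv s.
- by move=> m Φ β h sβ [Em]; apply: safe_tick; apply: IH; rewrite Em.
- by move=> m Φ x k h sk [Em]; apply: safe_alloc => l hl; apply: IH; rewrite Em; exact: sk.
- by move=> m Φ l k h c hl sk [Em]; apply: (safe_dealloc hl); apply: IH; rewrite Em.
- by move=> m Φ l f k h c hl sk [Em]; apply: (safe_atomic hl); apply: IH; rewrite Em.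
- move=> m Φ Ψ t k h h1 s st sk [Em]; apply: (safe_fork (Ψ := Ψ) s).
    by apply: IH; rewrite Em.
  by apply: IH; rewrite Em.
Qed.

Lemma bind_of_val h (v : ITV affE) : bind h (of_val v) = h v.
Proof. by case: v => a; [exact: bind_Ret|exact: bind_Fun]. Qed.

Lemma bind_Tick h (α : ITa) : bind h (Tick α) = Tick (bind h α).
Proof. exact: bind_Tau. Qed.

(** Bind rule and frame rule in one. [h1] is memory set aside for [f]: [α] works on cells of [h] and
    allocates outside [h'], so [h1] arrives intact. Surplus memory in [h'] is harmless, as ownership
    is affine. *)
Lemma safe_bind n (Φ Ψ : post) (f : ITV affE -n> ITa) α h h1 h' :
  safe n Φ α h -> ph_disj h h1 -> ph_sub h h' -> ph_sub h1 h' ->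
  (forall m v h0 h'', Φ v h0 -> ph_disj h0 h1 -> ph_sub h0 h'' -> ph_sub h1 h'' ->
     safe m Ψ (f v) h'') ->
  safe n Ψ (bind f α) h'.
Proof.
move=> sα; elim: sα h' => {n Φ α h}.
- by move=> *; exact: safe_0.
- move=> n Φ v h0 h Φv s0 h' d s s1 fP; rewrite bind_of_val.
  apply: fP Φv _ _ s1; last exact: ph_sub_trans s.
  exact: ph_disj_sub d s0 _.
- by move=> n Φ β h _ IH h' d s s1 fP; rewrite bind_Tick; apply: safe_tick; exact: IH.
- move=> n Φ x k h _ IH h' d s s1 fP; rewrite bind_Vis; apply: safe_alloc => l h'l /=.
  have h1l := ph_sub_None s1 h'l.
  apply: IH fP; first exact: ph_sub_None h'l.
  + exact: ph_disj_set.
  + exact: ph_sub_set.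
  + exact: ph_sub_setr.
- move=> n Φ l k h c hl _ IH h' d s s1 fP; rewrite bind_Vis.
  have h1l := ph_disj_Some d hl.
  apply: (safe_dealloc (s _ _ hl)) => /=; apply: IH fP.
  + exact: ph_disj_set.
  + exact: ph_sub_set.
  + exact: ph_sub_setr.
- move=> n Φ l g k h c hl _ IH h' d s s1 fP; rewrite bind_Vis.
  have h1l := ph_disj_Some d hl.
  apply: (safe_atomic (s _ _ hl)) => /=; apply: IH fP.
  + exact: ph_disj_set.
  + exact: ph_sub_set.
  + exact: ph_sub_setr.
(* [bind] leaves the forked thread as it is, so [st] is reused; its part [h2] lies in [h], away from
   [h1]. *)
- move=> n Φ Φ' t k h h2 s2 st _ _ IH h' d s s1 fP; rewrite bind_Vis.
  apply: (safe_fork (ph_sub_trans s2 s) st) => /=; apply: IH fP.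
  + apply: ph_disj_sub d _ _ => //; exact: ph_diff_sub.
  + exact: ph_sub_diff.
  + by apply: ph_sub_diffr => //; apply: ph_disj_sym; exact: ph_disj_sub d s2 _.
Qed.

(** * Types as predicates *)

Definition thunk_body (l : loc) (α : ITa) : ITa :=
  IF (XCHG l (Ret (GNat 1))) (Err Lin) α.

Definition zero_cell : later ITa := Next (Ret (GNat 0)).

(** [g] is fixed only pointwise, which avoids naming the nonexpansiveness proof inside [Thunk]. The
    flag lies outside [h0], so that raising it does not disturb what [v] owns. *)
Definition thunk_valid (V : post) (α : ITa) (h : pheap) : Prop :=
  exists l v h0 (g : ITa -n> ITa),
    [/\ α = Fun (Next g), forall β, g β = thunk_body l (of_val v) &
        [/\ h l = Some zero_cell, h0 l = None, ph_sub h0 h & V v h0]].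

(** The arrow clause asks for safety at every index, so no index enters the recursion. A call
    consumes what the function and its argument own. *)
Fixpoint valid (τ : ty) : post := fun v h =>
  match τ with
  | TBool | TNat => exists n, v = VRet (GNat n)
  | TUnit => v = VRet GUnit
  | TTensor τ1 τ2 => exists v1 v2 h1 h2,
      [/\ v = VRet (GPair v1 v2), ph_disj h1 h2, ph_sub h1 h & ph_sub h2 h] /\
      (valid τ1 v1 h1 /\ valid τ2 v2 h2)
  | TLolli τ1 τ2 => exists2 g : later (ITa -n> ITa), v = VFun g &
      forall n α h1 h', thunk_valid (valid τ1) α h1 ->
        ph_disj h h1 -> ph_sub h h' -> ph_sub h1 h' ->
        safe n (valid τ2) (later_car g α) h'
  | TRef τ => exists l v0 h0, v = VRet (GLoc l) /\
      [/\ h l = Some (Next (of_val v0)), h0 l = None, ph_sub h0 h & valid τ v0 h0]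
  end.

Definition env_valid (Γ : ctx) (ρ : env) (h : pheap) : Prop :=
  exists hs : var -> pheap,
    [/\ forall x, ph_sub (hs x) h, forall x y, x != y -> ph_disj (hs x) (hs y) &
        forall x τ, Γ.[? x]%fmap = Some τ -> thunk_valid (valid τ) (ρ x) (hs x)].

Lemma env_valid_sub Γ ρ h h' : ph_sub h h' -> env_valid Γ ρ h -> env_valid Γ ρ h'.
Proof.
by move=> s [hs [hsh hsd hsT]]; exists hs; split=> // x; exact: ph_sub_trans s.
Qed.

Lemma env_valid_upd Γ ρ h x τ α h1 h' :
  env_valid Γ ρ h -> thunk_valid (valid τ) α h1 ->
  ph_disj h h1 -> ph_sub h h' -> ph_sub h1 h' ->
  env_valid Γ.[x <- τ]%fmap (upd x ρ α) h'.
Proof.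
move=> [hs [hsh hsd hsT]] Tα d s s1.
exists (fun y => if y == x then h1 else hs y); split.
- by move=> y; case: ifP => // _; exact: ph_sub_trans s.
- move=> y z; case: (y =P x) => [->|_]; case: (z =P x) => [->|_]; rewrite ?eqxx //.
  + by move=> _; apply: ph_disj_sym; exact: ph_disj_sub d (hsh z) _.
  + by move=> _; exact: ph_disj_sub d (hsh y) _.
  + exact: hsd.
- by move=> y τ'; rewrite fnd_set /=; case: eqP => [_ [<-]|_] //; exact: hsT.
Qed.

(** The first half consists of the cells owned by some variable of [Γ1], the second of all the
    others. Distinct variables own disjoint parts, so no cell of a variable of [Γ2] falls into the
    first half. *)
Lemma env_valid_split Γ Γ1 Γ2 ρ h : splits Γ Γ1 Γ2 -> env_valid Γ ρ h ->
  exists h1 h2, [/\ env_valid Γ1 ρ h1, env_valid Γ2 ρ h2, ph_disj h1 h2,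
                    ph_sub h1 h & ph_sub h2 h].
Proof.
move=> [/fdisjointP disj ->] [hs [hsh hsd hsT]].
pose h1 l := if `[< exists2 x, x \in Γ1 & hs x l <> None >] then h l else None.
have hs1 x : x \in Γ1 -> ph_sub (hs x) h1.
  move=> xΓ1 l c hl; rewrite /h1; case: asboolP => [_|[]]; first exact: hsh hl.
  by exists x; rewrite // hl.
have s1 : ph_sub h1 h by move=> l c; rewrite /h1; case: asboolP.
have hs2 x : x \in Γ2 -> ph_sub (hs x) (ph_diff h h1).
  move=> xΓ2; apply: ph_sub_diffr => // l; rewrite /h1; case: asboolP => [[y yΓ1]|_].
    move=> hyl; left; have /hsd/(_ l)[] // : x != y.
    by apply: contraL xΓ2 => /eqP->; exact: disj.
  by right.
have restr (Γ' : ctx) h' : (forall x, x \in Γ' -> ph_sub (hs x) h') ->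
    (forall x τ, Γ'.[? x]%fmap = Some τ -> ((Γ1 + Γ2)%fset : ctx).[? x]%fmap = Some τ) ->
    env_valid Γ' ρ h'.
  (* Variables outside [Γ'] get the empty part, as theirs need not lie in [h']. *)
  move=> hs' ΓΓ; exists (fun x => if x \in Γ' then hs x else ph_empty); split.
  - by move=> x; case: ifP => // /hs'.
  - move=> x y xy; case: ifP => _; case: ifP => _ //; exact: hsd.
  - by move=> x τ E; rewrite -fndSome E /=; apply: hsT; exact: ΓΓ.
exists h1, (ph_diff h h1); split => //.
(* On a common key [+] keeps the right-hand value; disjointness of the domains excludes this
   case. *)
- apply: restr => // x τ E; rewrite fnd_cat; case: ifP => // x2.
  have /disj : x \in domf Γ1 by rewrite -fndSome E.
  by rewrite x2.
- by apply: restr => // x τ E; rewrite fnd_cat -fndSome E.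
- by apply: ph_disj_sym; exact: ph_disj_diff.
- exact: ph_diff_sub.
Qed.

(** * Typed terms are safe *)

(** The equation on [α] leaves room for projections of a pair, which become values only after
    rewriting with [bind_Ret]. *)
Lemma safe_bind_Thunk n Ψ (f : ITV affE -n> ITa) α v h :
  α = of_val v ->
  (forall m l (g : ITa -n> ITa), h l = None ->
     (forall β, g β = thunk_body l (of_val v)) ->
     safe m Ψ (f (VFun (Next g))) (ph_set h l (Some zero_cell))) ->
  safe n Ψ (bind f (Thunk α)) h.
Proof.
move=> -> fP; case: n => [|n]; first exact: safe_0.
rewrite -[X in bind _ X]/(Vis alloc_op _ _) bind_Vis.
by apply: safe_alloc => l hl /=; rewrite bind_Fun; exact: fP.
Qed.

Lemma thunk_valid_alloc (V : post) l v (g : ITa -n> ITa) h :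
  h l = None -> (forall β, g β = thunk_body l (of_val v)) -> V v h ->
  thunk_valid V (Fun (Next g)) (ph_set h l (Some zero_cell)).
Proof.
move=> hl gE Vv; exists l, v, h, g; split=> //; split=> //; first exact: ph_set_same.
exact: ph_sub_setr.
Qed.

(** Owning the flag at 0 rules out [Err Lin]: the exchange returns 0, so [IF] takes the branch of
    the value, and the flag now at 1 lies outside the part [h0] of that value. *)
Lemma safe_Force n V α h : thunk_valid V α h -> safe n V (Force α) h.
Proof.
case=> l [v [h0 [g [-> gE [hl h0l s Vv]]]]]; case: n => [|n]; first exact: safe_0.
rewrite -[Force _]/(bind _ (Ret _)) bind_Ret.
rewrite -[X in safe _ _ X _]/(bind _ (Fun _)) bind_Fun.
apply: safe_tick; rewrite gE; case: n => [|n]; first exact: safe_0.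
rewrite -[thunk_body _ _]/(bind _ (Vis atomic_op _ _)) bind_Vis.
apply: (safe_atomic hl) => /=; rewrite bind_Ret /=.
case: n => [|n]; first exact: safe_0.
by apply: safe_val Vv _; exact: ph_sub_setr.
Qed.

(** Fundamental lemma, by induction on typing. In a rule with two premises the owned memory is split
    along the contexts; one half is set aside by [safe_bind], or handed to a forked thread, while
    the other is used. *)
Lemma typed_safe Γ e τ n ρ h :
  typed Γ e τ -> env_valid Γ ρ h -> safe n (valid τ) (interp e ρ) h.
Proof.
have safe_ret m (Φ : post) v h' : Φ v h' -> safe m Φ (of_val v) h'.
  by move=> Φv; case: m => [|m]; [exact: safe_0|exact: safe_val Φv _].
move=> De; elim: De n ρ h => {Γ e τ}.
- by move=> Γ b n ρ h _; apply: (safe_ret _ _ (VRet _)); eexists.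
- by move=> Γ b n ρ h _; apply: (safe_ret _ _ (VRet _)); eexists.
- by move=> Γ n ρ h _; exact: (safe_ret _ _ (VRet _)).
- move=> Γ x τ Γx n ρ h [hs [hsh _ hsT]]; case: (hsT x τ Γx) => l [v [h0 [g]]].
  move=> [ρx gE [hl h0l s Vv]]; apply: safe_Force; exists l, v, h0, g; split=> //.
  by split=> //; [exact: hsh hl|exact: ph_sub_trans (hsh x)].
- move=> Γ x e τ1 τ2 _ IH n ρ h Gρ; apply: (safe_ret _ _ (VFun _)).
  eexists; first by [].
  by move=> m α h1 h' Tα d s s1; apply: IH; exact: env_valid_upd Tα d s s1.
- move=> Γ Γ1 Γ2 e1 e2 τ1 τ2 sp _ I1 _ I2 n ρ h Gρ.
  have {Gρ}[h1 [h2 [G1 G2 d s1 s2]]] := env_valid_split sp Gρ.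
  apply: (safe_bind (I2 n ρ h2 G2) (ph_disj_sym d) s2 s1) => m v h0 h' Vv d0 s0 s1'.
  rewrite -[X in safe _ _ X _]/(bind _ (Thunk (of_val v))).
  apply: (@safe_bind_Thunk _ _ _ _ v _ erefl) => m' l g h'l gE.
  have h1l := ph_sub_None s1' h'l.
  have h0l := ph_sub_None s0 h'l.
  (* While [e1] runs, the part of the new thunk is set aside: its flag and the memory of the
     argument. *)
  apply: (safe_bind (I1 m' ρ h1 G1) (h1 := ph_set h0 l (Some zero_cell))).
  + by apply: ph_disj_sym; exact: ph_disj_set.
  + exact: ph_sub_setr.
  + exact: ph_sub_set.
  move=> {}m w h3 h'' [f -> fP] d3 s3 s0' /=.
  case: m => [|m]; first exact: safe_0.
  by apply: safe_tick; apply: fP s3 s0' => //; exact: thunk_valid_alloc.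
- move=> Γ Γ1 Γ2 e1 e2 τ1 τ2 sp _ I1 _ I2 n ρ h Gρ.
  have {Gρ}[h1 [h2 [G1 G2 d s1 s2]]] := env_valid_split sp Gρ.
  apply: (safe_bind (I2 n ρ h2 G2) (ph_disj_sym d) s2 s1) => m v h0 h' Vv d0 s0 s1'.
  apply: (safe_bind (I1 m ρ h1 G1) (ph_disj_sym d0) s1' s0) => {}m w h3 h'' Vw d3 s3 s0' /=.
  apply: (safe_ret _ _ (VRet _)); exists w, v, h3, h0; by do !split.
- move=> Γ Γ1 Γ2 x1 x2 e1 e2 τ1 τ2 τ sp _ I1 _ I2 n ρ h Gρ.
  have {Gρ}[h1 [h2 [G1 G2 d s1 s2]]] := env_valid_split sp Gρ.
  apply: (safe_bind (I1 n ρ h1 G1) d s1 s2) => m v h0 h'.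
  move=> [v1 [v2 [ha [hb [[-> dab sa sb] [Va Vb]]]]]] d0 s0 s2'.
  rewrite -[X in safe _ _ X _]/(bind _ (Thunk _)).
  apply: (@safe_bind_Thunk _ _ _ _ v1); first by rewrite /= bind_Ret.
  move=> {}m l1 g1 h'l1 gE1.
  rewrite -[X in safe _ _ X _]/(bind _ (Thunk _)).
  apply: (@safe_bind_Thunk _ _ _ _ v2); first by rewrite /= bind_Ret.
  move=> {}m l2 g2 h'l2 gE2.
  have h0l1 := ph_sub_None s0 h'l1.
  have h2l1 := ph_sub_None s2' h'l1.
  have hal1 := ph_sub_None sa h0l1.
  have hbl1 := ph_sub_None sb h0l1.
  have s2'' := ph_sub_setr (Some zero_cell) h2l1 s2'.
  have sa' : ph_sub (ph_set ha l1 (Some zero_cell)) (ph_set h' l1 (Some zero_cell)).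
    by apply: ph_sub_set; exact: ph_sub_trans s0.
  have sb' : ph_sub hb (ph_set h' l1 (Some zero_cell)).
    by apply: ph_sub_setr => //; exact: ph_sub_trans s0.
  have hbl2 := ph_sub_None sb' h'l2.
  apply: I2.
  (* All but the part of the second component: it carries the environment extended by [x1] and is
     disjoint from the thunk for [x2]. *)
  pose hr := ph_diff (ph_set h' l1 (Some zero_cell)) hb.
  apply: (@env_valid_upd _ _ hr _ _ _ (ph_set hb l2 (Some zero_cell))).
  + apply: (@env_valid_upd _ _ _ _ _ _ (ph_set ha l1 (Some zero_cell)) _ G2).
    * exact: thunk_valid_alloc.
    * apply: ph_disj_sym; apply: ph_disj_set => //.
      by apply: ph_disj_sub d0 sa _.
    * apply: ph_sub_diffr => //; apply: ph_disj_sym; exact: ph_disj_sub d0 sb _.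
    * by apply: ph_sub_diffr => //; exact: ph_disj_set.
  + exact: thunk_valid_alloc.
  + apply: ph_disj_sym; apply: ph_disj_set.
      by apply: ph_disj_sym; exact: ph_disj_diff.
    exact: ph_sub_None (@ph_diff_sub _ _) h'l2.
  + apply: ph_sub_setr; last exact: ph_diff_sub.
    exact: ph_sub_None (@ph_diff_sub _ _) h'l2.
  + exact: ph_sub_set.
- move=> Γ e τ _ IH n ρ h Gρ.
  apply: (safe_bind (IH n ρ h Gρ) (h1 := ph_empty)) => // m v h0 h' Vv _ s0 _.
  case: m => [|m]; first exact: safe_0.
  apply: safe_alloc => l h'l; apply: (safe_ret _ _ (VRet _)).
  have h0l := ph_sub_None s0 h'l.
  exists l, v, h0; split=> //; split=> //; first exact: ph_set_same.
  exact: ph_sub_setr.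
- move=> Γ e τ _ IH n ρ h Gρ.
  apply: (safe_bind (IH n ρ h Gρ) (h1 := ph_empty)) => // m v h0 h'.
  move=> [l [v0 [h1 [-> [h0l _ _ _]]]]] _ s0 _ /=.
  case: m => [|m]; first exact: safe_0.
  (* The memory owned by the content is abandoned: the unit value needs none. *)
  apply: (safe_dealloc (s0 _ _ h0l)); exact: (safe_ret _ _ (VRet _)).
- move=> Γ Γ1 Γ2 e1 e2 τ1 τ2 sp _ I1 _ I2 n ρ h Gρ.
  have {Gρ}[h1 [h2 [G1 G2 d s1 s2]]] := env_valid_split sp Gρ.
  apply: (safe_bind (I2 n ρ h2 G2) (ph_disj_sym d) s2 s1) => m v h0 h' Vv d0 s0 s1'.
  apply: (safe_bind (I1 m ρ h1 G1) (ph_disj_sym d0) s1' s0) => {}m w h3 h''.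
  move=> [l [u [h4 [-> [h3l h4l s4 Vu]]]]] d3 s3 s0'.
  case: m => [|m]; first exact: safe_0.
  rewrite -[X in safe _ _ X _]/(bind _ (Vis atomic_op _ _)) bind_Vis.
  apply: (safe_atomic (s3 _ _ h3l)) => /=.
  rewrite bind_of_val /= bind_Ret /= bind_of_val /=; apply: (safe_ret _ _ (VRet _)).
  have h0l := ph_disj_Some d3 h3l.
  (* The old content leaves with its part [h4]; the reference now owns the cell [l] and the part
     [h0] of the new content, possibly of another type. *)
  exists u, (VRet (GLoc l)), h4, (ph_set h0 l (Some (Next (of_val v)))); do !split => //.
  + apply: ph_disj_sym; apply: ph_disj_set => //; apply: ph_disj_sym.
    exact: ph_disj_sub d3 s4 _.
  + by apply: ph_sub_setr => //; exact: ph_sub_trans s3.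
  + exact: ph_sub_set.
  exists l, v, h0; do !split=> //; first exact: ph_set_same.
  exact: ph_sub_setr.
- move=> Γ Γ1 Γ2 e1 e2 τ sp _ I1 _ I2 n ρ h Gρ.
  have {Gρ}[h1 [h2 [G1 G2 d s1 s2]]] := env_valid_split sp Gρ.
  case: n => [|n]; first exact: safe_0.
  rewrite -[interp _ _]/(bind _ (Vis fork_op _ _)) bind_Vis.
  apply: (@safe_fork _ _ _ (Next (interp e1 ρ)) _ _ _ s1 (I1 n ρ h1 G1)) => /=.
  rewrite bind_Ret; apply: I2; apply: env_valid_sub G2.
  by apply: ph_sub_diffr => //; exact: ph_disj_sym.
Qed.

(** * Thread pools *)

Variant it_shape := ShVal | ShTau | ShVis of aff_op | ShErr.

(** [Ret], [Fun], [Tau] and [Vis] are maps into the solution of a domain equation, not Rocq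
    constructors; [shape] serves to tell them apart. *)
Definition shape (α : ITa) : it_shape :=
  match unfold_IT affE α with
  | inl _ | inr (inl _) => ShVal
  | inr (inr (inl _)) => ShErr
  | inr (inr (inr (inl _))) => ShTau
  | inr (inr (inr (inr p))) => ShVis (tag p)
  end.

Lemma shape_of_val (v : ITV affE) : shape (of_val v) = ShVal.
Proof. by case: v => a; rewrite /shape /= fold_ITK. Qed.

Lemma shape_Tick α : shape (Tick α) = ShTau.
Proof. by rewrite /shape /= fold_ITK. Qed.

Lemma shape_Vis i x k : shape (Vis i x k) = ShVis i.
Proof. by rewrite /shape /= fold_ITK. Qed.

Lemma Tick_inj (α β : ITa) : Tick α = Tick β -> α = β.
Proof. by move=> /(congr1 (unfold_IT affE)); rewrite /= !fold_ITK => -[]. Qed.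

(** Injectivity of [existT] at a fixed tag is obtained through distances: [sig_distE] disposes of
    the equation between tags by proof irrelevance. *)
Lemma Vis_inj (i : op affE) x k x' k' : Vis i x k = Vis i x' k' -> x = x' /\ k = k'.
Proof.
move=> /(congr1 (unfold_IT affE)); rewrite /= !fold_ITK.
pose p : sigC (visIT (E := affE)) := existT _ i (x, k).
pose p' : sigC (visIT (E := affE)) := existT _ i (x', k').
pose get (z : itT affE) := if z is inr (inr (inr (inr q))) then q else p.
move=> /(congr1 get) E; have {}E : p = p' by exact: E.
suff: (x, k) = (x', k') :> visIT i by case.
apply: dist_eq => n; apply/(sig_distE (A := visIT (E := affE))).
by rewrite -/p -/p' E; exact: sig_dist_refl.
Qed.

(** * Progress and preservation for a single thread *)

Definition own (σ : heap) : pheap := fun l => σ.[? l]%fmap.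

Lemma own_set (σ : heap) l c : own (σ.[l <- c]%fmap) = ph_set (own σ) l (Some c).
Proof. by apply: funext => l'; rewrite /own /ph_set fnd_set. Qed.

Lemma own_rem (σ : heap) l : own (σ.[~ l]%fmap) = ph_set (own σ) l None.
Proof. by apply: funext => l'; rewrite /own /ph_set fnd_rem1; case: eqP. Qed.

Lemma own_notin (σ : heap) l : l \notin domf σ -> own σ l = None.
Proof. exact: not_fnd. Qed.

(** A reifier fails only on a cell missing from the heap, and the rules of [safe] exhibit that cell
    in [h]. At index 0 [safe] says nothing, hence [n.+1]. *)
Lemma safe_progress fresh n Φ α h σ : safe n.+1 Φ α h -> ph_sub h (own σ) ->
  is_value α \/ exists β σ' l, step fresh α σ β σ' l.
Proof.
have visS i x k r σ' l' : reify fresh x σ k = Some (r, σ', l') ->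
    is_value (Vis (i : op affE) x k) \/
    exists β σ' l, step fresh (Vis i x k) σ β σ' l.
  move=> E; right; exists (later_car r), σ', [seq later_car t | t <- l'].
  by apply: (@step_vis _ _ _ _ _ _ i x k l').
move=> sα; move Em : n.+1 sα => m sα; case: sα Em => {m Φ α h} //.
- move=> m Φ [a|f] h0 h _ _ _ _; left; first by left; exists a.
  by right; exists f.
- by move=> m Φ β h _ _ _; right; exists β, σ, [::]; exact: step_tick.
- by move=> m Φ x k h _ _ _; exact: (visS alloc_op).
- move=> m Φ l k h c hl _ _ s; have E := s _ _ hl.
  by apply: (visS dealloc_op) => /=; rewrite [(_ .[? _])%fmap]E.
- move=> m Φ l f k h c hl _ _ s; have E := s _ _ hl.
  by apply: (visS atomic_op) => /=; rewrite [(_ .[? _])%fmap]E.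
- by move=> m Φ Ψ t k h h1 _ _ _ _ _; exact: (visS fork_op).
Qed.

(** [hr] stands for the part of any other thread, [h'] and [hf] for the new parts of the stepping
    thread and of its child. *)
Definition frame_preserved (h : pheap) (σ : heap) (h' hf : pheap) (σ' : heap) :=
  forall hr, ph_disj h hr -> ph_sub hr (own σ) ->
    [/\ ph_sub hr (own σ'), ph_disj h' hr & ph_disj hf hr].

(** The head constructor matches the step with the rule that made [α] safe, and the new parts are
    read off from that rule. A new location is outside all of [σ], hence outside [h] and every
    frame. *)
Lemma safe_preservation fresh (fresh_notin : forall D : {fset loc}, fresh D \notin D)
    n Φ α h σ β σ' l :
  safe n.+1 Φ α h -> ph_sub h (own σ) -> step fresh α σ β σ' l ->
  exists h' hf,
    [/\ safe n Φ β h',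
        l = [::] \/ exists t Ψ, l = [:: t] /\ safe n Ψ t hf,
        [/\ ph_sub h' (own σ'), ph_sub hf (own σ') & ph_disj h' hf] &
        frame_preserved h σ h' hf σ'].
Proof.
move=> sα; move Em : n.+1 sα => m sα; case: sα Em => {m Φ α h} //.
- move=> m Φ v h0 h _ _ _ _ [E|i x k l' E]; move/(congr1 shape): E.
    by rewrite shape_of_val shape_Tick.
  by rewrite shape_of_val shape_Vis.
- move=> m Φ β' h sβ [->] s [/Tick_inj <- -> ->|i x k l' E].
    by exists h, ph_empty; split=> //; left.
  by move/(congr1 shape): E; rewrite shape_Tick shape_Vis.
- move=> m Φ x k h sk [->] s [E|i x' k' l' E].
    by move/(congr1 shape): E; rewrite shape_Tick shape_Vis.
  have := congr1 shape E; rewrite !shape_Vis => -[ei].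
  case: i / ei x' k' E => x' k' /Vis_inj[<- <-] [Eβ <- <-] ->.
  have {Eβ}<- : later_car (k (fresh (domf σ))) = β by rewrite Eβ.
  have σl := own_notin (fresh_notin (domf σ)); have hl := ph_sub_None s σl.
  exists (ph_set h (fresh (domf σ)) (Some x)), ph_empty; rewrite /frame_preserved own_set.
  split=> //; [exact: sk|by left|split=> //; exact: ph_sub_set|].
  move=> hr d sr; have hrl := ph_sub_None sr σl; split=> //.
    exact: ph_sub_setr.
  exact: ph_disj_set.
- move=> m Φ l0 k h c hl sk [->] s [E|i x' k' l' E].
    by move/(congr1 shape): E; rewrite shape_Tick shape_Vis.
  have := congr1 shape E; rewrite !shape_Vis => -[ei].
  case: i / ei x' k' E => x' k' /Vis_inj[<- <-] /=.
  have σl := s _ _ hl; rewrite [(_ .[? _])%fmap]σl => -[Eβ <- <-] ->.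
  have {Eβ}<- : later_car (k tt) = β by rewrite Eβ.
  exists (ph_set h l0 None), ph_empty; rewrite /frame_preserved own_rem.
  split=> //; [by left|split=> //; exact: ph_sub_set|].
  move=> hr d sr; have hrl := ph_disj_Some d hl; split=> //.
    exact: ph_sub_setr.
  exact: ph_disj_set.
- move=> m Φ l0 f k h c hl sk [->] s [E|i x' k' l' E].
    by move/(congr1 shape): E; rewrite shape_Tick shape_Vis.
  have := congr1 shape E; rewrite !shape_Vis => -[ei].
  case: i / ei x' k' E => x' k' /Vis_inj[<- <-] /=.
  have σl := s _ _ hl; rewrite [(_ .[? _])%fmap]σl => -[Eβ <- <-] ->.
  have {Eβ}<- : later_car (k (Next (later_car f (later_car c)).1)) = β by rewrite Eβ.
  eexists (ph_set h l0 _), ph_empty; rewrite /frame_preserved own_set.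
  split=> //; [exact: sk|by left|split=> //; exact: ph_sub_set|].
  move=> hr d sr; have hrl := ph_disj_Some d hl; split=> //.
    exact: ph_sub_setr.
  exact: ph_disj_set.
- move=> m Φ Ψ t k h h1 s1 st sk [->] s [E|i x' k' l' E].
    by move/(congr1 shape): E; rewrite shape_Tick shape_Vis.
  have := congr1 shape E; rewrite !shape_Vis => -[ei].
  case: i / ei x' k' E => x' k' /Vis_inj[<- <-] [Eβ <- <-] ->.
  have {Eβ}<- : later_car (k tt) = β by rewrite Eβ.
  exists (ph_diff h h1), h1; split=> //.
  + by right; exists (later_car t), Ψ.
  + split; [|exact: ph_sub_trans s|exact: ph_disj_diff].
    exact: ph_sub_trans (@ph_diff_sub _ _) s.
  + move=> hr d sr; split=> //; last exact: ph_disj_sub d s1 _.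
    by apply: ph_disj_sub d _ _ => //; exact: ph_diff_sub.
Qed.

(** * Safety of a whole pool *)

Definition pool_safe n (c : config) : Prop :=
  exists hs : nat -> pheap,
    [/\ forall i, ph_sub (hs i) (own c.2), forall i j, i != j -> ph_disj (hs i) (hs j) &
        forall i, i < size c.1 -> exists Φ, safe n Φ (nth (Err RunTime) c.1 i) (hs i)].

Lemma pool_safe_step fresh (fresh_notin : forall D : {fset loc}, fresh D \notin D) n c c' :
  pool_safe n.+1 c -> tp_step fresh c c' -> pool_safe n c'.
Proof.
case: c c' => [αs σ] [αs' σ'] [hs [/= hsσ hsd hsS]] [i [β [l [/= iα st ->]]]].
have [Φ sα] := hsS i iα.
have [h' [hf [sβ lS [h's hfs dhf] frm]]] := safe_preservation fresh_notin sα (hsσ i) st.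
have frmj j : j != i -> [/\ ph_sub (hs j) (own σ'), ph_disj h' (hs j) & ph_disj hf (hs j)].
  by move=> ji; apply: frm => //; apply: hsd; rewrite eq_sym.
have szα : size (set_nth (Err RunTime) αs i β) = size αs.
  by rewrite size_set_nth; apply/maxn_idPr.
(* A forked thread lands at index [size αs], where no thread was before. Without a fork this index
   stays outside the pool. *)
pose hs' j := if j == i then h' else if j == size αs then hf else hs j.
exists hs'; split=> /=.
- move=> j; rewrite /hs'; case: eqVneq => // ji; case: eqP => // _.
  by case: (frmj j ji).
- move=> j k jk; rewrite /hs'.
  case: (j =P i) jk => [->|/eqP ji]; case: (k =P i) => [->|/eqP ki]; rewrite ?eqxx // => jk.
  + by case: eqP => // _; case: (frmj k ki).
  + by apply: ph_disj_sym; case: eqP => // _; case: (frmj j ji).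
  + case: (j =P size αs) jk => [->|_]; case: (k =P size αs) => [->|_]; rewrite ?eqxx // => jk.
    * by case: (frmj k ki).
    * by apply: ph_disj_sym; case: (frmj j ji).
    * exact: hsd.
- move=> j; rewrite size_cat szα nth_cat szα => jl; rewrite /hs'.
  case: ltnP => [jα|αj].
    rewrite nth_set_nth /= (ltn_eqF jα); case: eqP => [_|_]; first by exists Φ.
    by have [Φ' /safe_pred] := hsS j jα; exists Φ'.
  case: eqP => [ji|_]; first by move: αj; rewrite ji leqNgt iα.
  case: lS => [l0|[t [Ψ [lt sT]]]]; first by move: jl; rewrite l0 addn0 ltnNge αj.
  move: jl; rewrite lt addn1 ltnS => jα.
  have -> : j = size αs by apply/eqP; rewrite eqn_leq jα.
  by rewrite eqxx subnn; exists Ψ.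
Qed.

(** Each step costs one unit of the index, so safety at all indices survives runs of any length. *)
Lemma pool_safe_steps fresh (fresh_notin : forall D : {fset loc}, fresh D \notin D) c c' :
  (forall n, pool_safe n c) -> tp_steps fresh c c' ->
  forall n, pool_safe n c'.
Proof.
move=> cS st; elim: st cS => // c0 c1 c2 c01 _ IH cS.
apply: IH => n; exact: (pool_safe_step fresh_notin (cS n.+1) c01).
Qed.

Theorem theorem7p2 (fresh : {fset loc} -> loc)
    (fresh_notin : forall D : {fset loc}, fresh D \notin D)
    (e : expr) (τ : ty) (αs : seq ITa) (σ σ' : heap) :
  typed fmap0 e τ ->
  tp_steps fresh ([:: interp e empty_env], σ) (αs, σ') ->
  forall i : nat, i < size αs ->
    let α := nth (Err RunTime) αs i in
    is_value α \/
    exists (β : ITa) (σ'' : heap) (l : seq ITa), step fresh α σ' β σ'' l.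
Proof.
move=> De st i iα /=.
(* A closed term owns nothing at the start, whatever [σ] contains. *)
have init n : pool_safe n ([:: interp e empty_env], σ).
  exists (fun=> ph_empty); split=> // -[|//] _; exists (valid τ).
  by apply: typed_safe De _; exists (fun=> ph_empty); split=> // x τ'; rewrite fnd_fmap0.
(* Index 1 is enough for one more step of any thread. *)
have [hs [hsσ _ hsS]] := pool_safe_steps fresh_notin init st 1.
by have [Φ /safe_progress] := hsS i iα; apply.
Qed.
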